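(* Let $\mathcal{R}$, $\mathcal{S}$ and $\mathcal{T}$ be essentially small triangulated categories such that the opposite categories satisfy $\mathrm{findim}(\mathcal{R}^{\mathrm{op}})<+\infty$ and $\mathrm{findim}(\mathcal{T}^{\mathrm{op}})<+\infty$. Suppose that $\mathcal{R}$ and $\mathcal{T}$ have bounded $t$-structures and that there is a recollement $(i^*,i_*=i_!,i^!;\,j_!,j^!=j^*,j_* )$ of $\mathcal{S}$ by $\mathcal{R}$ and $\mathcal{T}$ (with $i_*:\mathcal{R}\to\mathcal{S}$ and $j^*:\mathcal{S}\to\mathcal{T}$). Then $\mathcal{S}$ is regular.
   Context: Recollement is in the usual sense of Beilinson–Bernstein–Deligne. A $t$-structure $(\mathcal{S}^{\le 0},\mathcal{S}^{\ge 1})$ is bounded if $\mathcal{S}=\bigcup_{m\geq 1}\mathcal{S}^{\le 0}[-m]=\bigcup_{m\geq 1}\mathcal{S}^{\geq 1}[m]$. Finite finitistic dimension: for a triangulated category $\mathcal{U}$ and $G\in\mathcal{U}$, let $\langle G\rangle^{[0,+\infty)}$ be the smallest full subcategory containing $G$ and closed under extensions, direct summands and negative shifts, let $G(-\infty,-1]^{\perp}=\{X\in\mathcal{U}\mid\mathrm{Hom}_{\mathcal{U}}(G[n],X)=0\ \forall n\ge1\}$, and $\mathrm{findim}(\mathcal{U},G)=\inf\{n\in\mathbb{N}\mid G(-\infty,-1]^{\perp}\subseteq\langle G\rangle^{[0,+\infty)}[n]\}$. Write $\mathrm{findim}(\mathcal{U})<+\infty$ if $\mathrm{findim}(\mathcal{U},G)<+\infty$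 for some $G\in\mathcal{U}$. Regularity: an essentially small triangulated category $\mathcal{S}$ is regular if there is an object $G\in\mathcal{S}$ such that $\mathcal{S}$ is equivalent to $\mathfrak{S}_G(\mathcal{S})$ as triangulated categories. Here $\mathfrak{S}_G(\mathcal{S})$ is Neeman's completion of $\mathcal{S}$ with respect to the good metric $\{\mathcal{M}_n\}_{n\ge 1}$ defined by $G$, where $\mathcal{M}_n=\langle G\rangle^{(-\infty,-n]}$ is the smallest full subcategory containing $G[i]$ for all $i\ge n$ and closed under extensions and direct summands. Explicitly: let $Y:\mathcal{S}\to\mathrm{Mod}\text{-}\mathcal{S}$ be the Yoneda functor into additive functors $\mathcal{S}^{\mathrm{op}}\to\mathbb{Z}\text{-Mod}$. A sequence $E_1\to E_2\to\cdots$ in $\mathcal{S}$ is Cauchy if for every $n$ there is $N$ such that the cone of $E_i\to E_j$ lies in $\mathcal{M}_n$ for all $j\ge i\ge N$. Let $\mathfrak{L}$ be the full subcategory of $\mathrm{Mod}\text{-}\mathcal{S}$ of functors isomorphic to $\varinjlim Y(E_i)$ for a Cauchy sequence $(E_i)$; let $\mathfrak{C}$ be the full subcategory of functors $F$ with $F(\mathcal{M}_n)=0$ for some $n$. Then $\mathfrak{S}_G(\mathcal{S})=\mathfrak{L}\cap\mathfrak{C}$, with shift $F[1]=F((-)[-1])$ and distinguished triangles those sequences $A\to B\to C\to A[1]$ in $\mathfrak{S}_G(\mathcal{S})$ isomorphic to colimits of Yoneda images of sequences of distinguished triangles in $\mathcal{S}$ whose three component sequences are Cauchy. *)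

(* Defs.v *)
From HB Require Import structures.
From mathcomp Require Import all_boot all_order all_algebra.
From mathcomp Require Import boolp.

Set Implicit Arguments.
Unset Strict Implicit.
Unset Printing Implicit Defensive.

Import GRing.Theory.
Local Open Scope ring_scope.

Record category := Category {
  ob :> Type;
  hom : ob -> ob -> Type;
  idm : forall X, hom X X;
  comp : forall X Y Z, hom Y Z -> hom X Y -> hom X Z;
  comp1m : forall X Y (f : hom X Y), comp (idm Y) f = f;
  compm1 : forall X Y (f : hom X Y), comp f (idm X) = f;
  compA : forall X Y Z W (h : hom Z W) (g : hom Y Z) (f : hom X Y),
    comp h (comp g f) = comp (comp h g) f }.

Arguments idm {c} X.
Arguments comp {c X Y Z} g f.

Notation "g \c f" := (comp g f) (at level 40, left associativity).

Definition is_iso (C : category) (X Y : C) (f : hom X Y) : Prop :=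
  exists2 g : hom Y X, g \c f = idm X & f \c g = idm Y.

Definition isomorphic (C : category) (X Y : C) : Prop :=
  exists f : hom X Y, is_iso f.

Definition opcat (C : category) : category :=
  @Category (ob C) (fun X Y => hom Y X) (@idm C)
    (fun X Y Z g f => f \c g)
    (fun X Y f => compm1 f) (fun X Y f => comp1m f)
    (fun X Y Z W h g f => esym (compA f g h)).

Record functor (C D : category) := Functor {
  fob :> C -> D;
  fmap : forall X Y : C, hom X Y -> hom (fob X) (fob Y);
  fmap1 : forall X, fmap (idm X) = idm (fob X);
  fmapM : forall (X Y Z : C) (g : hom Y Z) (f : hom X Y),
    fmap (g \c f) = fmap g \c fmap f }.

Arguments fmap {C D} _ {X Y} _.

Definition idF (C : category) : functor C C :=
  @Functor C C (fun X => X) (fun X Y f => f)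
    (fun X => erefl) (fun X Y Z g f => erefl).

Section FunctorComp.
Variables (C D E : category) (G : functor D E) (F : functor C D).

Fact fcomp1 (X : C) : fmap G (fmap F (idm X)) = idm (G (F X)).
Proof. by rewrite !fmap1. Qed.

Fact fcompM (X Y Z : C) (g : hom Y Z) (f : hom X Y) :
  fmap G (fmap F (g \c f)) = fmap G (fmap F g) \c fmap G (fmap F f).
Proof. by rewrite !fmapM. Qed.

Definition fcomp : functor C E :=
  @Functor C E (fun X => G (F X)) (fun X Y f => fmap G (fmap F f))
    fcomp1 fcompM.
End FunctorComp.

Definition opF (C D : category) (F : functor C D) :
    functor (opcat C) (opcat D) :=
  @Functor (opcat C) (opcat D) F (fun X Y f => @fmap C D F Y X f)
    (fun X => fmap1 F X) (fun X Y Z g f => fmapM F f g).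

Record nattrans (C D : category) (F G : functor C D) := NatTrans {
  ncomp :> forall X : C, hom (F X) (G X);
  nnat : forall (X Y : C) (f : hom X Y),
    ncomp Y \c fmap F f = fmap G f \c ncomp X }.

Definition natiso (C D : category) (F G : functor C D)
  (a : nattrans F G) : Prop := forall X, is_iso (a X).

Lemma nattrans_ext (C D : category) (F G : functor C D)
  (a b : nattrans F G) : (forall X, a X = b X) -> a = b.
Proof.
case: a b => [a an] [b bn] /= ab.
have {}ab : a = b by apply: functional_extensionality_dep.
by subst b; congr NatTrans; apply: Prop_irrelevance.
Qed.

Definition nid (C D : category) (F : functor C D) : nattrans F F.
Proof.
exists (fun X => idm (F X)) => X Y f.
by rewrite comp1m compm1.
Defined.

Definition nvcomp (C D : category) (F G H : functor C D)
  (b : nattrans G H) (a : nattrans F G) : nattrans F H.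
Proof.
exists (fun X => b X \c a X) => X Y f.
by rewrite -compA nnat compA nnat compA.
Defined.

(* [whisker a K] has component [a (K X)] at [X]. *)
Definition whisker (B C D : category) (F G : functor C D)
  (a : nattrans F G) (K : functor B C) : nattrans (fcomp F K) (fcomp G K).
Proof. by exists (fun X => a (K X)) => X Y f; exact: (nnat a (fmap K f)). Defined.

Record adjunction (C D : category) (L : functor C D) (R : functor D C) :=
  Adjunction {
    adj_unit : nattrans (idF C) (fcomp R L);
    adj_counit : nattrans (fcomp L R) (idF D);
    adj_triL : forall X, adj_counit (L X) \c fmap L (adj_unit X) = idm (L X);
    adj_triR : forall Y, fmap R (adj_counit Y) \c adj_unit (R Y) = idm (R Y) }.

Definition fully_faithful (C D : category) (F : functor C D) : Prop :=
  forall X Y : C, bijective (@fmap C D F X Y).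

Definition is_equivalence (C D : category) (F : functor C D) : Prop :=
  exists (Q : functor D C)
    (a : nattrans (fcomp Q F) (idF C)) (b : nattrans (fcomp F Q) (idF D)),
    natiso a /\ natiso b.

Definition fullsub (C : category) (P : C -> Prop) : category :=
  @Category {X : C | P X} (fun X Y => hom (sval X) (sval Y))
    (fun X => idm (sval X)) (fun X Y Z g f => g \c f)
    (fun X Y f => comp1m f) (fun X Y f => compm1 f)
    (fun X Y Z W h g f => compA h g f).

(* A category whose hom-types carry an addition, with a shift functor and a
   class of distinguished triangles, but no axioms relating these data.  The
   axioms of a triangulated category are in [is_triangulated]; here only what
   is needed to say what a triangle functor is. *)
Record shiftcat := ShiftCat {
  sc_cat :> category;
  sc_add : forall X Y : sc_cat, hom X Y -> hom X Y -> hom X Y;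
  sc_sus : functor sc_cat sc_cat;
  sc_dist : forall X Y Z : sc_cat,
    hom X Y -> hom Y Z -> hom Z (sc_sus X) -> Prop }.

Arguments sc_add {s X Y} _ _.
Arguments sc_dist {s X Y Z} _ _ _.

Record trifunctor (A B : shiftcat) := TriFunctor {
  tf_fun :> functor A B;
  tf_add : forall (X Y : A) (f g : hom X Y),
    fmap tf_fun (sc_add f g) = sc_add (fmap tf_fun f) (fmap tf_fun g);
  tf_shift : nattrans (fcomp tf_fun (sc_sus A)) (fcomp (sc_sus B) tf_fun);
  tf_shift_iso : natiso tf_shift;
  tf_dist : forall (X Y Z : A) (u : hom X Y) (v : hom Y Z)
      (w : hom Z (sc_sus A X)),
    sc_dist u v w ->
    sc_dist (fmap tf_fun u) (fmap tf_fun v) (tf_shift X \c fmap tf_fun w) }.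

(* The last clause (triangles are reflected) is automatic when both sides
   satisfy the axioms of a triangulated category. *)
Definition tri_equivalent (A B : shiftcat) : Prop :=
  exists F : trifunctor A B,
    is_equivalence F /\
    forall (X Y Z : A) (u : hom X Y) (v : hom Y Z) (w : hom Z (sc_sus A X)),
      sc_dist (fmap F u) (fmap F v) (tf_shift F X \c fmap F w) ->
      sc_dist u v w.

(* This is not an extension of [category]: the hom-types of [category] live in
   a universe large enough for functor categories, those of [preadd] in the
   universe of [zmodType], so that hom-groups can be values of functors to
   abelian groups. *)
Record preadd := PreAdd {
  pob : Type;
  phom : pob -> pob -> zmodType;
  pid : forall X, phom X X;
  pcomp : forall X Y Z, phom Y Z -> phom X Y -> phom X Z;
  pcomp1m : forall X Y (f : phom X Y), pcomp (pid Y) f = f;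
  pcompm1 : forall X Y (f : phom X Y), pcomp f (pid X) = f;
  pcompA : forall X Y Z W (h : phom Z W) (g : phom Y Z) (f : phom X Y),
    pcomp h (pcomp g f) = pcomp (pcomp h g) f;
  pcompDl : forall X Y Z (g g' : phom Y Z) (f : phom X Y),
    pcomp (g + g') f = pcomp g f + pcomp g' f;
  pcompDr : forall X Y Z (g : phom Y Z) (f f' : phom X Y),
    pcomp g (f + f') = pcomp g f + pcomp g f' }.

Coercion cat_of (C : preadd) : category :=
  @Category (pob C) (fun X Y => phom X Y) (@pid C) (@pcomp C)
    (@pcomp1m C) (@pcompm1 C) (@pcompA C).

(* Additive data with an auto-equivalence [sus] (the shift [1]), a chosen
   quasi-inverse [loop] (the shift [-1]) and a class of candidate triangles
   X -> Y -> Z -> X[1]; the axioms are in [is_triangulated]. *)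
Record tridata := TriData {
  td_cat :> preadd;
  sus : functor td_cat td_cat;
  loop : functor td_cat td_cat;
  loop_sus : adjunction loop sus;
  loop_sus_unit_iso : natiso (adj_unit loop_sus);
  loop_sus_counit_iso : natiso (adj_counit loop_sus);
  dist : forall X Y Z : td_cat, hom X Y -> hom Y Z -> hom Z (sus X) -> Prop }.

Arguments sus {t}.
Arguments loop {t}.
Arguments loop_sus {t}.
Arguments dist {t X Y Z} _ _ _.

Notation "X [+1]" := (sus X) (at level 1, left associativity, format "X [+1]").
Notation "X [-1]" := (loop X) (at level 1, left associativity, format "X [-1]").

Fixpoint sus_iter (C : tridata) (k : nat) (X : C) : C :=
  match k with 0 => X | k'.+1 => (sus_iter k' X)[+1] end.

Fixpoint loop_iter (C : tridata) (k : nat) (X : C) : C :=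
  match k with 0 => X | k'.+1 => (loop_iter k' X)[-1] end.

Definition shift (C : tridata) (n : int) (X : C) : C :=
  match n with
  | Posz k => sus_iter k X
  | Negz k => loop_iter k.+1 X
  end.

Definition is_zero_ob (C : preadd) (X : C) : Prop := idm X = 0.

(* [S] is a direct sum of [X] and [Y]. *)
Definition is_dirsum (C : preadd) (X Y S : C) : Prop :=
  exists (i1 : hom X S) (i2 : hom Y S) (p1 : hom S X) (p2 : hom S Y),
    [/\ p1 \c i1 = idm X, p2 \c i2 = idm Y, p2 \c i1 = 0, p1 \c i2 = 0
      & i1 \c p1 + i2 \c p2 = idm S].

Record is_triangulated (C : tridata) : Prop := IsTriangulated {
  sus_add : forall (X Y : C) (f g : hom X Y),
    fmap sus (f + g) = fmap sus f + fmap sus g;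
  has_zero_ob : exists X : C, is_zero_ob X;
  has_dirsum : forall X Y : C, exists S, is_dirsum X Y S;
  dist_iso : forall (X Y Z X' Y' Z' : C)
      (u : hom X Y) (v : hom Y Z) (w : hom Z X[+1])
      (u' : hom X' Y') (v' : hom Y' Z') (w' : hom Z' X'[+1])
      (a : hom X X') (b : hom Y Y') (c : hom Z Z'),
    is_iso a -> is_iso b -> is_iso c ->
    b \c u = u' \c a -> c \c v = v' \c b -> fmap sus a \c w = w' \c c ->
    dist u v w -> dist u' v' w';
  dist_id : forall X Z : C, is_zero_ob Z ->
    dist (idm X) (0 : hom X Z) (0 : hom Z X[+1]);
  dist_cone : forall (X Y : C) (u : hom X Y),
    exists (Z : C) (v : hom Y Z) (w : hom Z X[+1]), dist u v w;
  dist_rot : forall (X Y Z : C) (u : hom X Y) (v : hom Y Z) (w : hom Z X[+1]),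
    dist u v w <-> dist v w (- fmap sus u);
  dist_mor : forall (X Y Z X' Y' Z' : C)
      (u : hom X Y) (v : hom Y Z) (w : hom Z X[+1])
      (u' : hom X' Y') (v' : hom Y' Z') (w' : hom Z' X'[+1])
      (a : hom X X') (b : hom Y Y'),
    dist u v w -> dist u' v' w' -> b \c u = u' \c a ->
    exists c : hom Z Z', c \c v = v' \c b /\ fmap sus a \c w = w' \c c;
  dist_oct : forall (X Y Z A B D : C) (f : hom X Y) (g : hom Y Z)
      (p1 : hom Y A) (d1 : hom A X[+1])
      (p2 : hom Z B) (d2 : hom B X[+1])
      (p3 : hom Z D) (d3 : hom D Y[+1]),
    dist f p1 d1 -> dist (g \c f) p2 d2 -> dist g p3 d3 ->
    exists (a : hom A B) (b : hom B D),
      [/\ dist a b (fmap sus p1 \c d3),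
          a \c p1 = p2 \c g, d2 \c a = d1,
          b \c p2 = p3 & d3 \c b = fmap sus f \c d2] }.

Record tricat := TriCat {
  tc_data :> tridata;
  tc_axioms : is_triangulated tc_data }.

Definition sh_of (C : tridata) : shiftcat :=
  @ShiftCat C (fun X Y (f g : hom X Y) => f + g) sus (@dist C).

(* The universe of [I] is independent of that of the objects of [C], so this is
   not satisfied trivially by I = ob C; hom-groups are always small. *)
Definition essentially_small (C : preadd) : Prop :=
  exists (I : Type) (s : I -> C), forall X : C, exists i, isomorphic X (s i).

Definition op_preadd (C : preadd) : preadd :=
  @PreAdd C (fun X Y => phom Y X) (@pid C) (fun X Y Z g f => pcomp f g)
    (fun X Y f => pcompm1 f) (fun X Y f => pcomp1m f)
    (fun X Y Z W h g f => esym (pcompA f g h))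
    (fun X Y Z g g' f => pcompDr f g g')
    (fun X Y Z g f f' => pcompDl f f' g).

Section Opposite.
Variable C : tridata.

Definition op_functor (F : functor C C) :
    functor (op_preadd C) (op_preadd C) :=
  @Functor (op_preadd C) (op_preadd C) F (fun X Y f => @fmap C C F Y X f)
    (fun X => fmap1 F X) (fun X Y Z g f => fmapM F f g).

Definition op_unit :
    nattrans (idF (op_preadd C)) (fcomp (op_functor loop) (op_functor sus)) :=
  @NatTrans (op_preadd C) (op_preadd C) (idF _)
    (fcomp (op_functor loop) (op_functor sus))
    (fun X => adj_counit (@loop_sus C) X)
    (fun X Y f => esym (nnat (adj_counit (@loop_sus C)) f)).

Definition op_counit :
    nattrans (fcomp (op_functor sus) (op_functor loop)) (idF (op_preadd C)) :=
  @NatTrans (op_preadd C) (op_preadd C)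
    (fcomp (op_functor sus) (op_functor loop)) (idF _)
    (fun X => adj_unit (@loop_sus C) X)
    (fun X Y f => esym (nnat (adj_unit (@loop_sus C)) f)).

Definition op_loop_sus : adjunction (op_functor sus) (op_functor loop) :=
  @Adjunction (op_preadd C) (op_preadd C) (op_functor sus) (op_functor loop)
    op_unit op_counit
    (adj_triR (@loop_sus C)) (adj_triL (@loop_sus C)).

Fact op_unit_iso : natiso (adj_unit op_loop_sus).
Proof.
by move=> X; have [g gf fg] := @loop_sus_counit_iso C X; exists g.
Qed.

Fact op_counit_iso : natiso (adj_counit op_loop_sus).
Proof.
by move=> X; have [g gf fg] := @loop_sus_unit_iso C X; exists g.
Qed.

(* The shift of the opposite category is [loop].  The triangle
   X -u-> Y -v-> Z -w-> X[-1] of the opposite category is distinguished when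
   Z -v-> Y -u-> X -(- w[1])-> Z[1] is distinguished in [C], where w[1] is
   precomposed with the unit X = X[-1][1]. *)
Definition op_tri : tridata :=
  @TriData (op_preadd C) (op_functor loop) (op_functor sus) op_loop_sus
    op_unit_iso op_counit_iso
    (fun (X Y Z : C) (u : hom Y X) (v : hom Z Y) (w : hom X[-1] Z) =>
       dist v u (- (fmap sus w \c adj_unit loop_sus X) : hom X Z[+1])).
End Opposite.

Section Generation.
Variables (C : tridata) (G : C).

(* <G>^[0,+oo) *)
Inductive gen_nonneg : C -> Prop :=
| gnn_base : gen_nonneg G
| gnn_ext (X Y Z : C) (u : hom X Y) (v : hom Y Z) (w : hom Z X[+1]) :
    dist u v w -> gen_nonneg X -> gen_nonneg Z -> gen_nonneg Y
| gnn_summand (X Y S : C) : is_dirsum X Y S -> gen_nonneg S -> gen_nonneg X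
| gnn_shift (X : C) : gen_nonneg X -> gen_nonneg X[-1].

(* <G>^(-oo,-n] *)
Inductive gen_le (n : nat) : C -> Prop :=
| gle_base (i : nat) : (n <= i)%N -> gen_le n (shift i G)
| gle_ext (X Y Z : C) (u : hom X Y) (v : hom Y Z) (w : hom Z X[+1]) :
    dist u v w -> gen_le n X -> gen_le n Z -> gen_le n Y
| gle_summand (X Y S : C) : is_dirsum X Y S -> gen_le n S -> gen_le n X.

(* G(-oo,-1]^perp *)
Definition perp (X : C) : Prop :=
  forall n : nat, (1 <= n)%N -> forall f : hom (shift n G) X, f = 0.
End Generation.

(* X belongs to the full subcategory P[n]. *)
Definition shifted (C : tridata) (P : C -> Prop) (n : int) (X : C) : Prop :=
  exists2 Y : C, P Y & isomorphic X (shift n Y).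

(* The infimum defining findim(U, G) is finite exactly when it is taken over
   a nonempty set. *)
Definition findim_finite_at (U : tridata) (G : U) : Prop :=
  exists n : nat, forall X : U, perp G X -> shifted (gen_nonneg G) n X.

Definition findim_finite (U : tridata) : Prop :=
  exists G : U, findim_finite_at G.

Record tstructure (C : tridata) := TStructure {
  t_le0 : C -> Prop;
  t_ge1 : C -> Prop;
  t_le0_iso : forall X Y : C, isomorphic X Y -> t_le0 X -> t_le0 Y;
  t_ge1_iso : forall X Y : C, isomorphic X Y -> t_ge1 X -> t_ge1 Y;
  t_le0_shift : forall X : C, t_le0 X -> t_le0 X[+1];
  t_ge1_shift : forall X : C, t_ge1 X -> t_ge1 X[-1];
  t_orth : forall (X Y : C) (f : hom X Y), t_le0 X -> t_ge1 Y -> f = 0;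
  t_trunc : forall X : C, exists (A B : C) (u : hom A X) (v : hom X B)
    (w : hom B A[+1]), [/\ t_le0 A, t_ge1 B & dist u v w] }.

Definition t_bounded (C : tridata) (t : tstructure C) : Prop :=
  (forall X : C, exists2 m : nat, (1 <= m)%N & shifted (t_le0 t) (- m%:Z) X) /\
  (forall X : C, exists2 m : nat, (1 <= m)%N & shifted (t_ge1 t) m%:Z X).

Record recollement (R S T : tricat) := Recollement {
  i_pull : trifunctor (sh_of S) (sh_of R);   (* i^* *)
  i_push : trifunctor (sh_of R) (sh_of S);   (* i_* = i_! *)
  i_shriek : trifunctor (sh_of S) (sh_of R); (* i^! *)
  j_shriek : trifunctor (sh_of T) (sh_of S); (* j_! *)
  j_pull : trifunctor (sh_of S) (sh_of T);   (* j^! = j^* *)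
  j_push : trifunctor (sh_of T) (sh_of S);   (* j_* *)
  adj_ipull : adjunction i_pull i_push;
  adj_ishriek : adjunction i_push i_shriek;
  adj_jshriek : adjunction j_shriek j_pull;
  adj_jpush : adjunction j_pull j_push;
  i_push_ff : fully_faithful i_push;
  j_shriek_ff : fully_faithful j_shriek;
  j_push_ff : fully_faithful j_push;
  j_pull_i_push : forall X : R, @is_zero_ob T (j_pull (i_push X));
  recol_tri_shriek : forall X : S,
    exists w : hom (i_push (i_pull X)) (j_shriek (j_pull X))[+1],
      @dist S _ _ _ (adj_counit adj_jshriek X) (adj_unit adj_ipull X) w;
  recol_tri_push : forall X : S,
    exists w : hom (j_push (j_pull X)) (i_push (i_shriek X))[+1],
      @dist S _ _ _ (adj_counit adj_ishriek X) (adj_unit adj_jpush X) w }.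

Lemma additive_ext (U V : zmodType) (f g : {additive U -> V}) :
  f =1 g -> f = g.
Proof.
case: f g => [f [[fm]]] [g [[gm]]] /= fg.
have {}fg : f = g by apply: functional_extensionality_dep.
by subst g; rewrite (Prop_irrelevance fm gm).
Qed.

Definition Ab : category.
Proof.
refine (@Category zmodType (fun U V => {additive U -> V})
  (fun U => (idfun : {additive U -> U}))
  (fun U V W g f => (g \o f : {additive U -> W})) _ _ _);
by move=> *; apply: additive_ext.
Defined.

(* Morphisms of [Ab] do not coerce to functions when they are presented as
   morphisms of a category; [fval], [act] and [nt_at] retype F X, F f and the
   components a_X. *)
Definition fval (C : category) (F : functor (opcat C) Ab) (X : C) : zmodType :=
  F X.

Definition act (C : category) (F : functor (opcat C) Ab) (X Y : C)
  (f : hom X Y) : {additive fval F Y -> fval F X} := @fmap (opcat C) Ab F Y X f.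

Definition nt_at (C : category) (F G : functor (opcat C) Ab)
  (a : nattrans F G) (X : C) : {additive fval F X -> fval G X} := a X.

Arguments fval {C} F X : simpl never.

Record module (C : preadd) := Module {
  mod_fun :> functor (opcat C) Ab;
  mod_add : forall (X Y : C) (f g : hom X Y) (x : fval mod_fun Y),
    act mod_fun (f + g) x = act mod_fun f x + act mod_fun g x }.

Section FunctorCategory.
Variables C D : category.

Fact nvcomp1m (F G : functor C D) (a : nattrans F G) : nvcomp (nid G) a = a.
Proof. by apply: nattrans_ext => X; apply: comp1m. Qed.

Fact nvcompm1 (F G : functor C D) (a : nattrans F G) : nvcomp a (nid F) = a.
Proof. by apply: nattrans_ext => X; apply: compm1. Qed.

Fact nvcompA (F G H K : functor C D)
    (c : nattrans H K) (b : nattrans G H) (a : nattrans F G) :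
  nvcomp c (nvcomp b a) = nvcomp (nvcomp c b) a.
Proof. by apply: nattrans_ext => X; apply: compA. Qed.
End FunctorCategory.

(* Mod-C; its objects are the additive functors C^op -> Ab. *)
Definition modcat (C : preadd) : category :=
  @Category (module C) (fun F G => nattrans F G)
    (fun F => nid F) (fun F G H b a => nvcomp b a)
    (fun F G a => nvcomp1m a) (fun F G a => nvcompm1 a)
    (fun F G H K c b a => nvcompA c b a).

Lemma nt_nat (C : category) (F G : functor (opcat C) Ab) (a : nattrans F G)
    (X Y : C) (f : hom X Y) (x : fval F Y) :
  nt_at a X (act F f x) = act G f (nt_at a Y x).
Proof. by have /(congr1 (fun h : {additive _ -> _} => h x)) := nnat a f. Qed.

Lemma nt_ext (C : category) (F G : functor (opcat C) Ab) (a b : nattrans F G) :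
  (forall X (x : fval F X), nt_at a X x = nt_at b X x) -> a = b.
Proof. by move=> ab; apply: nattrans_ext => X; apply: additive_ext; exact: ab. Qed.

Lemma act1 (C : category) (F : functor (opcat C) Ab) (X : C) (x : fval F X) :
  act F (idm X) x = x.
Proof.
by have /(congr1 (fun h : {additive _ -> _} => h x)) := fmap1 F X.
Qed.

Lemma actM (C : category) (F : functor (opcat C) Ab) (X Y Z : C)
    (g : hom Y Z) (f : hom X Y) (x : fval F Z) :
  act F (g \c f) x = act F f (act F g x).
Proof.
by have /(congr1 (fun h : {additive _ -> _} => h x)) :=
  @fmapM (opcat C) Ab F Z Y X f g.
Qed.

Definition mk_nt (C : category) (F G : functor (opcat C) Ab)
    (a : forall X, {additive fval F X -> fval G X})
    (an : forall (X Y : C) (f : hom X Y) (x : fval F Y),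
       a X (act F f x) = act G f (a Y x)) : nattrans F G.
Proof.
exists a => Y X f; apply: additive_ext => x; exact: (an X Y f x).
Defined.

Definition nt_add (C : category) (F G : functor (opcat C) Ab)
    (a b : nattrans F G) : nattrans F G.
Proof.
apply: (@mk_nt C F G
  (fun X => (nt_at a X \+ nt_at b X : {additive fval F X -> fval G X}))).
by move=> X Y f x /=; rewrite !nt_nat raddfD.
Defined.

Lemma compDl (C : preadd) (X Y Z : C) (g g' : hom Y Z) (f : hom X Y) :
  (g + g' : hom Y Z) \c f = g \c f + g' \c f.
Proof. exact: pcompDl. Qed.

Lemma compDr (C : preadd) (X Y Z : C) (g : hom Y Z) (f f' : hom X Y) :
  g \c (f + f') = g \c f + g \c f'.
Proof. exact: pcompDr. Qed.

Lemma comp0m (C : preadd) (X Y Z : C) (f : hom X Y) :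
  (0 : hom Y Z) \c f = 0.
Proof. by apply: (addrI ((0 : hom Y Z) \c f)); rewrite -compDl !addr0. Qed.

Lemma compm0 (C : preadd) (X Y Z : C) (g : hom Y Z) :
  g \c (0 : hom X Y) = 0.
Proof. by apply: (addrI (g \c (0 : hom X Y))); rewrite -compDr !addr0. Qed.

Lemma compNl (C : preadd) (X Y Z : C) (g : hom Y Z) (f : hom X Y) :
  (- g : hom Y Z) \c f = - (g \c f).
Proof.
by apply/eqP; rewrite -addr_eq0 -compDl addNr comp0m.
Qed.

Lemma compNr (C : preadd) (X Y Z : C) (g : hom Y Z) (f : hom X Y) :
  g \c (- f) = - (g \c f).
Proof.
by apply/eqP; rewrite -addr_eq0 -compDr addNr compm0.
Qed.

Section Yoneda.
Variable C : preadd.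

Definition precomp (X X' E : C) (f : hom X X') (g : phom X' E) : phom X E :=
  @comp C X X' E g f.

Fact precomp_is_additive (X X' E : C) (f : hom X X') :
  zmod_morphism (@precomp X X' E f).
Proof. by move=> g g'; rewrite /precomp compDl compNl. Qed.

HB.instance Definition _ (X X' E : C) (f : hom X X') :=
  GRing.isZmodMorphism.Build (phom X' E) (phom X E) (@precomp X X' E f)
    (@precomp_is_additive X X' E f).

Definition yoneda_fun (E : C) : functor (opcat C) Ab.
Proof.
refine (@Functor (opcat C) Ab (fun X => phom X E)
  (fun X' X f => (@precomp X X' E f : {additive phom X' E -> phom X E})) _ _).
- by move=> X; apply: additive_ext => g; exact: (@pcompm1 C _ _ g).
- by move=> X Y Z g f; apply: additive_ext => h; exact: (@pcompA C _ _ _ _ h f g).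
Defined.

Definition yoneda (E : C) : module C.
Proof.
by exists (yoneda_fun E) => X Y f g h; exact: (@pcompDr C _ _ _ h f g).
Defined.

Definition postcomp (E E' X : C) (e : hom E E') (g : phom X E) : phom X E' :=
  @comp C X E E' e g.

Fact postcomp_is_additive (E E' X : C) (e : hom E E') :
  zmod_morphism (@postcomp E E' X e).
Proof. by move=> g g'; rewrite /postcomp compDr compNr. Qed.

HB.instance Definition _ (E E' X : C) (e : hom E E') :=
  GRing.isZmodMorphism.Build (phom X E) (phom X E') (@postcomp E E' X e)
    (@postcomp_is_additive E E' X e).

Definition yoneda_map (E E' : C) (e : hom E E') :
  nattrans (yoneda E) (yoneda E').
Proof.
apply: (@mk_nt C (yoneda E) (yoneda E')
  (fun X => (@postcomp E E' X e : {additive phom X E -> phom X E'}))).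
by move=> X Y f g; exact: (@pcompA C _ _ _ _ e g f).
Defined.

Definition Yo : functor C (modcat C).
Proof.
refine (@Functor C (modcat C) yoneda yoneda_map _ _).
- by move=> E; apply: nt_ext => X g; exact: (@pcomp1m C _ _ g).
- move=> E E' E'' e' e; apply: nt_ext => X g.
  exact: (esym (@pcompA C _ _ _ _ e' e g)).
Defined.
End Yoneda.

Section TriangulatedFacts.
Variable S : tricat.
Implicit Types X Y Z : S.

Let ax : is_triangulated S := tc_axioms S.

Lemma loop_sus_unit_nat X Y (f : hom X Y) :
  fmap sus (fmap loop f) \c adj_unit loop_sus X = adj_unit loop_sus Y \c f.
Proof. by symmetry; apply: (nnat (adj_unit (@loop_sus S))). Qed.

Lemma loop_sus_counit_nat X Y (f : hom X Y) :
  f \c adj_counit loop_sus X = adj_counit loop_sus Y \c fmap loop (fmap sus f).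
Proof. by symmetry; apply: (nnat (adj_counit (@loop_sus S))). Qed.

Lemma sus_faithful X Y (f g : hom X Y) : fmap sus f = fmap sus g -> f = g.
Proof.
move=> fg; have [h _ ch] := @loop_sus_counit_iso S X.
have E : f \c adj_counit loop_sus X = g \c adj_counit loop_sus X.
  by rewrite !loop_sus_counit_nat fg.
by rewrite -[f]compm1 -[g]compm1 -ch !compA E.
Qed.

Lemma sus0 X Y : fmap sus (0 : hom X Y) = 0.
Proof. by apply: (addrI (fmap sus (0 : hom X Y))); rewrite -(sus_add ax) !addr0. Qed.

Lemma susN X Y (f : hom X Y) : fmap sus (- f) = - fmap sus f.
Proof. by apply/eqP; rewrite -addr_eq0 -(sus_add ax) addNr sus0. Qed.

Lemma loop_add X Y (f g : hom X Y) :
  fmap loop (f + g) = fmap loop f + fmap loop g.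
Proof.
apply: sus_faithful; rewrite (sus_add ax).
have [h _ uh] := @loop_sus_unit_iso S X.
have N (k : hom X Y) :
    fmap sus (fmap loop k) = adj_unit loop_sus Y \c k \c h.
  by rewrite -loop_sus_unit_nat -compA uh compm1.
by rewrite !N compDr compDl.
Qed.

Lemma loop0 X Y : fmap loop (0 : hom X Y) = 0.
Proof. by apply: (addrI (fmap loop (0 : hom X Y))); rewrite -loop_add !addr0. Qed.

Lemma loopN X Y (f : hom X Y) : fmap loop (- f) = - fmap loop f.
Proof. by apply/eqP; rewrite -addr_eq0 -loop_add addNr loop0. Qed.

Lemma iso_id X : is_iso (idm X).
Proof. by exists (idm X); rewrite comp1m. Qed.

Lemma iso_opp X : is_iso (- idm X : hom X X).
Proof.
by exists (- idm X); rewrite compNl compNr opprK comp1m.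
Qed.

Lemma dist_sgn X Y Z (u : hom X Y) (v : hom Y Z) (w : hom Z X[+1]) :
  dist (- u) (- v) w -> dist u v w.
Proof.
apply: (dist_iso ax (iso_id X) (iso_opp Y) (iso_id Z)).
- by rewrite compNl compNr opprK comp1m compm1.
- by rewrite !compNr compm1 comp1m.
- by rewrite fmap1 comp1m compm1.
Qed.

Lemma dist_sus X Y Z (u : hom X Y) (v : hom Y Z) (w : hom Z X[+1]) :
  dist u v w -> dist (fmap sus u) (fmap sus v) (- fmap sus w).
Proof.
move=> /(dist_rot ax) /(dist_rot ax) /(dist_rot ax); exact: dist_sgn.
Qed.

Lemma dist_loop X Y Z (u : hom X Y) (v : hom Y Z) (w : hom Z X[+1]) :
  dist u v w -> exists w', @dist S _ _ _ (fmap loop u) (fmap loop v) w'.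
Proof.
move=> uvw.
exists (- (adj_unit loop_sus X \c adj_counit loop_sus X \c fmap loop w)).
apply: dist_sgn; apply/(dist_rot ax)/(dist_rot ax)/(dist_rot ax).
rewrite !susN !opprK !fmapM.
apply: (dist_iso ax (@loop_sus_unit_iso S X) (@loop_sus_unit_iso S Y)
  (@loop_sus_unit_iso S Z) _ _ _ uvw).
- by rewrite loop_sus_unit_nat.
- by rewrite loop_sus_unit_nat.
- rewrite -!compA loop_sus_unit_nat; congr (_ \c _).
  have := adj_triR (@loop_sus S) X => /(congr1 (fun h => comp h w)).
  by rewrite comp1m -compA.
Qed.

Lemma dirsum_sus X Y Z :
  is_dirsum X Y Z -> is_dirsum X[+1] Y[+1] Z[+1].
Proof.
move=> [i1 [i2 [p1 [p2 [e1 e2 e3 e4 e5]]]]].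
exists (fmap sus i1), (fmap sus i2), (fmap sus p1), (fmap sus p2).
by split; rewrite -!fmapM ?e1 ?e2 ?e3 ?e4 ?sus0 ?fmap1 // -(sus_add ax) e5 fmap1.
Qed.

Lemma dirsum_loop X Y Z :
  is_dirsum X Y Z -> is_dirsum X[-1] Y[-1] Z[-1].
Proof.
move=> [i1 [i2 [p1 [p2 [e1 e2 e3 e4 e5]]]]].
exists (fmap loop i1), (fmap loop i2), (fmap loop p1), (fmap loop p2).
by split; rewrite -!fmapM ?e1 ?e2 ?e3 ?e4 ?loop0 ?fmap1 // -loop_add e5 fmap1.
Qed.

Lemma dirsum_zero X Y Z : isomorphic X Y -> is_zero_ob Z -> is_dirsum X Z Y.
Proof.
move=> [f [g gf fg]] Z0; exists f, 0, g, 0.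
by split; rewrite ?comp0m ?compm0 ?addr0 ?Z0.
Qed.

Variable G : S.

Lemma gen_le_iso n X Y : isomorphic X Y -> gen_le G n Y -> gen_le G n X.
Proof.
move=> XY; have [Z Z0] := has_zero_ob ax.
exact/gle_summand/(dirsum_zero XY Z0).
Qed.

Lemma gen_le_sus n X : gen_le G n X -> gen_le G n X[+1].
Proof.
elim=> [i ni|A B D u v w uvw _ IA _ ID|A B D dAB _ ID].
- by apply: (@gle_base S G n i.+1); apply: leqW.
- exact: (gle_ext (dist_sus uvw)).
- exact: (gle_summand (dirsum_sus dAB)).
Qed.

Lemma gen_le_loop n X : gen_le G n.+1 X -> gen_le G n X[-1].
Proof.
elim=> [[//|i] ni|A B D u v w uvw _ IA _ ID|A B D dAB _ ID].
- apply: gen_le_iso (@gle_base S G n i ni).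
  by exists (adj_counit loop_sus (shift i G)); apply: loop_sus_counit_iso.
- have [w' uvw'] := dist_loop uvw; exact: (gle_ext uvw').
- exact: (gle_summand (dirsum_loop dAB)).
Qed.

Lemma gen_le_leq m n X : (m <= n)%N -> gen_le G n X -> gen_le G m X.
Proof.
move=> mn; elim=> [i ni|A B D u v w uvw _ IA _ ID|A B D dAB _ ID].
- by apply: gle_base; apply: leq_trans ni.
- exact: (gle_ext uvw).
- exact: (gle_summand dAB).
Qed.
End TriangulatedFacts.

Section ModuleShift.
Variable S : tricat.

(* F[1] = F((-)[-1]) *)
Definition mod_shift (F : module S) : module S.
Proof.
exists (fcomp F (opF (@loop S))) => X Y f g x.
by rewrite -(mod_add (fmap loop f)) -loop_add.
Defined.

Definition mod_shift_map (F F' : module S) (a : nattrans F F') :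
  nattrans (mod_shift F) (mod_shift F') := whisker a (opF (@loop S)).

Definition mod_sus : functor (modcat S) (modcat S).
Proof.
refine (@Functor (modcat S) (modcat S) mod_shift mod_shift_map _ _).
- by move=> F; apply: nattrans_ext.
- by move=> F F' F'' b a; apply: nattrans_ext.
Defined.

Definition loop_adjunct (X E : S) (g : phom X E[+1]) : phom X[-1] E :=
  @comp S _ _ _ (adj_counit loop_sus E) (fmap loop (g : hom X E[+1])).

Fact loop_adjunct_is_additive (X E : S) : zmod_morphism (@loop_adjunct X E).
Proof. by move=> g g'; rewrite /loop_adjunct loop_add loopN compDr compNr. Qed.

HB.instance Definition _ (X E : S) :=
  GRing.isZmodMorphism.Build (phom X E[+1]) (phom X[-1] E)
    (@loop_adjunct X E) (@loop_adjunct_is_additive X E).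

(* The isomorphism Y(E[1]) = Y(E)[1] given by the adjunction isomorphisms
   Hom(X, E[1]) -> Hom(X[-1], E). *)
Definition yoneda_shift (E : S) :
  nattrans (yoneda E[+1]) (mod_shift (yoneda E)).
Proof.
apply: (@mk_nt S (yoneda E[+1]) (mod_shift (yoneda E)) (fun X =>
  (@loop_adjunct X E : {additive phom X E[+1] -> phom X[-1] E}))).
move=> X Y f g.
rewrite -[LHS]/(adj_counit loop_sus E \c fmap loop ((g : hom Y E[+1]) \c f)).
by rewrite fmapM compA.
Defined.

Record seqn := Seqn {
  sq :> nat -> S;
  sq_map : forall i, hom (sq i) (sq i.+1) }.

Fixpoint sq_trans (E : seqn) (i k : nat) : hom (E i) (E (k + i)%N) :=
  match k with
  | 0 => idm (E i)
  | k'.+1 => sq_map E (k' + i)%N \c sq_trans E i k'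
  end.

Definition seq_sus (E : seqn) : seqn :=
  @Seqn (fun i => (E i)[+1]) (fun i => fmap sus (sq_map E i)).

Definition cocone (E : seqn) (F : modcat S) : Type :=
  forall i : nat, hom (Yo S (E i)) F.

Definition is_cocone (E : seqn) (F : modcat S) (c : cocone E F) : Prop :=
  forall i, c i.+1 \c fmap (Yo S) (sq_map E i) = c i.

Definition is_colimit (E : seqn) (F : modcat S) (c : cocone E F) : Prop :=
  is_cocone c /\
  forall (H : modcat S) (d : cocone E H), is_cocone d ->
    exists! a : hom F H, forall i, a \c c i = d i.

Definition cocone_shift (E : seqn) (F : modcat S) (c : cocone E F) :
    cocone (seq_sus E) (mod_sus F) :=
  fun i => fmap mod_sus (c i)
    \c (yoneda_shift (E i) : hom (Yo S (E i)[+1]) (mod_sus (Yo S (E i)))).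

Variable G : S.

(* M_n = <G>^(-oo,-n] *)
Definition is_cauchy (E : seqn) : Prop :=
  forall n, (1 <= n)%N -> exists N, forall i k, (N <= i)%N ->
    exists (Z : S) (v : hom (E (k + i)%N) Z) (w : hom Z (E i)[+1]),
      dist (sq_trans E i k) v w /\ gen_le G n Z.

Definition in_L (F : modcat S) : Prop :=
  exists (E : seqn) (c : cocone E F), is_cauchy E /\ is_colimit c.

Definition in_C (F : modcat S) : Prop :=
  exists2 n, (1 <= n)%N &
    forall X : S, gen_le G n X -> forall x : fval (F : module S) X, x = 0.

Definition in_completion (F : modcat S) : Prop := in_L F /\ in_C F.

Lemma seq_sus_trans (E : seqn) i k :
  sq_trans (seq_sus E) i k = fmap sus (sq_trans E i k).
Proof. by elim: k => [|k IH] /=; rewrite ?fmap1 // fmapM IH. Qed.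

Lemma is_cauchy_sus (E : seqn) : is_cauchy E -> is_cauchy (seq_sus E).
Proof.
move=> cE n n1; have [N EN] := cE n n1; exists N => i k Ni.
have [Z [v [w [uvw Zn]]]] := EN i k Ni.
exists Z[+1], (fmap sus v), (- fmap sus w); rewrite seq_sus_trans.
by split; [apply: dist_sus | apply: gen_le_sus].
Qed.

Definition yo_act (F : module S) (E X : S) (x : fval F E) (f : phom X E) :
  fval F X := @act S F X E f x.

Fact yo_act_is_additive (F : module S) (E X : S) (x : fval F E) :
  zmod_morphism (@yo_act F E X x).
Proof.
move=> f g; apply/eqP; rewrite eq_sym subr_eq; apply/eqP.
by rewrite /yo_act -(@mod_add S F X E) subrK.
Qed.

HB.instance Definition _ (F : module S) (E X : S) (x : fval F E) :=
  GRing.isZmodMorphism.Build (phom X E) (fval F X) (@yo_act F E X x)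
    (@yo_act_is_additive F E X x).

Definition yo_elt (F : module S) (E : S) (x : fval F E) :
  nattrans (yoneda E) F.
Proof.
apply: (@mk_nt S (yoneda E) F
  (fun X => (@yo_act F E X x : {additive phom X E -> fval F X}))) => X Y f g.
exact: (@actM S F X Y E g f x).
Defined.

Lemma nt_yonedaE (F : module S) (E X : S) (c : nattrans (yoneda E) F)
    (f : phom X E) :
  nt_at c X f = @act S F X E f (nt_at c E (pid E)).
Proof.
rewrite -(@nt_nat S (yoneda E) F c X E f); congr (nt_at c X _).
by symmetry; exact: (@pcomp1m S _ _ f).
Qed.

(* F((-)[1]) *)
Definition mod_unshift (F : module S) : module S.
Proof.
exists (fcomp F (opF (@sus S))) => X Y f g x.
by rewrite -(mod_add (fmap sus f)) -(sus_add (tc_axioms S)).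
Defined.

Definition mod_unshiftK (F : module S) :
  nattrans (mod_shift (mod_unshift F)) F.
Proof.
apply: (@mk_nt S (mod_shift (mod_unshift F)) F
  (fun X => @act S F X X[-1][+1] (adj_unit loop_sus X))) => X Y f x.
rewrite -[LHS](@actM S F _ _ _ (fmap sus (fmap loop f)) (adj_unit loop_sus X)).
by rewrite loop_sus_unit_nat actM.
Defined.

Section ColimitShift.
Variables (E : seqn) (F : module S) (c : cocone E F).
Hypothesis cF : is_colimit c.

Lemma cocone_shiftE (i : nat) (X : S) (f : hom X (E i)[+1]) :
  nt_at (cocone_shift c i) X f =
  nt_at (c i) X[-1] (adj_counit loop_sus (E i) \c fmap loop f).
Proof. by []. Qed.

Lemma cocone_shift_cocone : is_cocone (cocone_shift c).
Proof.
move=> i; apply: nt_ext => X f.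
have -> : nt_at (cocone_shift c i.+1 \c fmap (Yo S) (sq_map (seq_sus E) i)) X f
  = nt_at (cocone_shift c i.+1) X (fmap sus (sq_map E i) \c (f : hom X _)).
  by [].
rewrite !cocone_shiftE fmapM compA -loop_sus_counit_nat -compA.
rewrite -[in RHS](cF.1 i).
by [].
Qed.

Lemma cocone_shift_exists (H : module S) (d : cocone (seq_sus E) H) :
  is_cocone d ->
  exists a : @hom (modcat S) (mod_shift F) H, 
   forall i, a \c cocone_shift c i = d i.
Proof.
move=> dc.
pose d' : cocone E (mod_unshift H) :=
  fun i => @yo_elt (mod_unshift H) (E i) (nt_at (d i) (E i)[+1] (pid (E i)[+1])).
have d'E i X (f : hom X (E i)) :
  nt_at (d' i) X f = nt_at (d i) X[+1] (fmap sus f).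
  by rewrite (nt_yonedaE (d i)).
have d'c : is_cocone d'.
  move=> i; apply: nt_ext => X f.
  rewrite -[LHS]/(nt_at (d' i.+1) X (sq_map E i \c (f : hom X (E i)))).
  by rewrite !d'E fmapM -[in RHS](dc i).
have [b [bd _]] := cF.2 (mod_unshift H) d' d'c.
exists (nvcomp (mod_unshiftK H) (mod_shift_map b)) => i.
apply: nt_ext => X f.
rewrite -[LHS]/(@act S H X X[-1][+1] (adj_unit loop_sus X)
  (nt_at b X[-1] (nt_at (cocone_shift c i) X f))).
rewrite cocone_shiftE.
rewrite -[nt_at b _ _]/(nt_at (b \c c i) X[-1] _) bd d'E.
rewrite -(nt_nat (d i)).
congr (nt_at (d i) X _).
rewrite -[LHS]/(fmap sus (adj_counit loop_sus (E i) \c fmap loop (f : hom X _))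
  \c adj_unit loop_sus X).
rewrite fmapM -compA loop_sus_unit_nat compA.
have := adj_triR (@loop_sus S) (E i) => /(congr1 (fun h => comp h (f : hom X _))).
by rewrite comp1m.
Qed.

Lemma cocone_shift_unique (H : module S)
    (a b : @hom (modcat S) (mod_shift F) H) :
  (forall i, a \c cocone_shift c i = b \c cocone_shift c i) -> a = b.
Proof.
move=> ab.
have back : exists t : nattrans F (mod_unshift (mod_shift F)),
    forall X (x : fval F X),
      nt_at t X x = @act S F X[+1][-1] X (adj_counit loop_sus X) x.
  unshelve eexists.
    apply: (@mk_nt S F (mod_unshift (mod_shift F))
      (fun X => @act S F X[+1][-1] X (adj_counit loop_sus X))) => X Y f x.
    rewrite -[LHS](@actM S F _ _ _ f (adj_counit loop_sus X)).
    by rewrite loop_sus_counit_nat actM.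
  by [].
have [t tE] := back.
pose up (e : nattrans (mod_shift F) H) :
    nattrans (mod_unshift (mod_shift F)) (mod_unshift H) :=
  whisker e (opF (@sus S)).
pose ta : @hom (modcat S) F (mod_unshift H) := nvcomp (up a) t.
pose tb : @hom (modcat S) F (mod_unshift H) := nvcomp (up b) t.
have tab : ta = tb.
  have cc : is_cocone (fun i => ta \c c i : hom (Yo S (E i)) _).
    by move=> i; rewrite -compA cF.1.
  have [h [_ uh]] := cF.2 _ _ cc.
  rewrite -(uh ta) //; apply: uh => i.
  apply: nt_ext => X f.
  have key (e : nattrans (mod_shift F) H) :
      nt_at (up e) X (nt_at t X (nt_at (c i) X f)) =
      nt_at (nvcomp e (cocone_shift c i)) X[+1] (fmap sus (f : hom X _)).
    rewrite tE -(nt_nat (c i)).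
    rewrite -[RHS]/(nt_at e X[+1]
       (nt_at (cocone_shift c i) X[+1] (fmap sus (f : hom X _)))).
    by rewrite cocone_shiftE -loop_sus_counit_nat.
  rewrite -[LHS]/(nt_at (up b) X (nt_at t X (nt_at (c i) X f))).
  rewrite -[RHS]/(nt_at (up a) X (nt_at t X (nt_at (c i) X f))).
  by rewrite !key -[nvcomp b _]/(b \c cocone_shift c i) -ab.
apply: nt_ext => X x.
have key (e : nattrans (mod_shift F) H) :
    nt_at e X x = @act S H X X[-1][+1] (adj_unit loop_sus X)
       (nt_at (nvcomp (up e) t) X[-1] x).
  rewrite -[nt_at (nvcomp _ _) _ _]/(nt_at e X[-1][+1] (nt_at t X[-1] x)).
  rewrite -(nt_nat e) tE.
  congr (nt_at e X _).
  rewrite -[RHS](@actM S F _ _ _ (adj_counit loop_sus X[-1])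
     (fmap loop (adj_unit loop_sus X))).
  by rewrite adj_triL act1.
rewrite !key; congr (act _ _ _).
by have := congr1 (fun h : nattrans F (mod_unshift H) => nt_at h X[-1] x) tab.
Qed.

Lemma is_colimit_shift : is_colimit (cocone_shift c).
Proof.
split; first exact: cocone_shift_cocone.
move=> H d dc; have [a ad] := cocone_shift_exists dc.
exists a; split=> // b bd; apply: cocone_shift_unique => i.
by rewrite ad bd.
Qed.
End ColimitShift.

Lemma in_C_shift (F : modcat S) : in_C F -> in_C (mod_sus F).
Proof.
move=> [n n1 Fn]; exists n.+1 => // X Xn x.
by apply: (Fn X[-1]); apply: gen_le_loop.
Qed.

Lemma in_completion_shift (F : modcat S) :
  in_completion F -> in_completion (mod_sus F).
Proof.
move=> [[E [c [cE cF]]] FC]; split; last exact: in_C_shift.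
exists (seq_sus E), (cocone_shift c); split; first exact: is_cauchy_sus.
exact: is_colimit_shift.
Qed.
End ModuleShift.

Section Completion.
Variables (S : tricat) (G : S).

Definition compl_cat : category := fullsub (in_completion G).

Definition compl_sus : functor compl_cat compl_cat :=
  @Functor compl_cat compl_cat
    (fun F => exist _ (mod_sus S (sval F)) (in_completion_shift (svalP F)))
    (fun F F' a => fmap (mod_sus S) a)
    (fun F => fmap1 (mod_sus S) (sval F))
    (fun F F' F'' b a => fmapM (mod_sus S) b a).

(* f, g, h are the maps induced on colimits by the Yoneda images of a sequence
   of distinguished triangles of [S] with Cauchy components; the last term of
   the colimit triangle is identified with A[1] by [cocone_shift].  As colimits
   are determined up to isomorphism only, this includes all triangles
   isomorphic to such a colimit. *)
Definition colim_triangle (A B C : modcat S)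
    (f : hom A B) (g : hom B C) (h : hom C (mod_sus S A)) : Prop :=
  exists (a b c : seqn S)
    (u : forall i, hom (a i) (b i)) (v : forall i, hom (b i) (c i))
    (w : forall i, hom (c i) (a i)[+1])
    (p : cocone a A) (q : cocone b B) (r : cocone c C),
    [/\ forall i, dist (u i) (v i) (w i),
        forall i, [/\ sq_map b i \c u i = u i.+1 \c sq_map a i,
                      sq_map c i \c v i = v i.+1 \c sq_map b i
                    & fmap sus (sq_map a i) \c w i = w i.+1 \c sq_map c i],
        [/\ is_cauchy G a, is_cauchy G b & is_cauchy G c],
        [/\ is_colimit p, is_colimit q & is_colimit r]
      & forall i,
          [/\ f \c p i = q i \c fmap (Yo S) (u i),
              g \c q i = r i \c fmap (Yo S) (v i)
            & h \c r i = cocone_shift p i \c fmap (Yo S) (w i)]].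

Definition completion : shiftcat :=
  @ShiftCat compl_cat (fun F F' a b => nt_add a b) compl_sus
    (fun F F' F'' f g h =>
       @colim_triangle (sval F) (sval F') (sval F'') f g h).
End Completion.

Definition regular (S : tricat) : Prop :=
  exists G : S, tri_equivalent (sh_of S) (completion G).

(* Main.v *)
(* Call a class U an aisle if it is closed under extensions, summands and [1],
   and every X sits in a triangle A -> X -> B with A in U and B right orthogonal
   to U.  A bounded t-structure on R together with findim(R^op) < oo yields a
   bounded aisle U and an object G with U[c] contained in <G>^(-oo,0] for some c:
   G lies in some shift of the coaisle, so all far enough shifts of objects of U
   have no maps to G[-n], n >= 1.  Both properties glue along the recollement,
   with U = {X | j^*X in U_T, i^*X in U_R} and G = i_*G_R + j_!G_T.

   Given such U and G, the metric defined by G is equivalent to the one given by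
   the shifts of U.  Let F = colim Y(E_i), with (E_i) Cauchy, vanish on
   <G>^(-oo,-n], and truncate K -> E_N -> B with K in a suitable shift of U.  As
   F(K) = 0, the map E_N -> E_j factors through B for large j; as the cone of
   E_N -> E_j lies in a far shift of U, E_N -> B extends to E_j.  Hence B is a
   retract of E_j and represents F, so the Yoneda functor is an equivalence from
   S to its completion.  It reflects triangles by the five lemma: a sequence with
   representable colimit is essentially constant. *)

From HB Require Import structures.
From mathcomp Require Import all_boot all_order all_algebra.
From mathcomp Require Import boolp.
Require Import Defs.

Set Implicit Arguments.
Unset Strict Implicit.
Unset Printing Implicit Defensive.

Import GRing.Theory.
Local Open Scope ring_scope.

(** * Exactness in triangulated categories *)

Section Isomorphisms.
Variable C : category.
Implicit Types X Y Z : C.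

Lemma is_iso_comp X Y Z (g : hom Y Z) (f : hom X Y) :
  is_iso g -> is_iso f -> is_iso (g \c f).
Proof.
move=> [g' g'g gg'] [f' f'f ff']; exists (f' \c g').
- by rewrite compA -(compA f') g'g compm1.
- by rewrite compA -(compA g) ff' compm1.
Qed.

Lemma isomorphic_refl X : isomorphic X X.
Proof. by exists (idm X), (idm X); rewrite comp1m. Qed.

Lemma isomorphic_sym X Y : isomorphic X Y -> isomorphic Y X.
Proof. by move=> [f [g gf fg]]; exists g, f. Qed.

Lemma isomorphic_trans X Y Z :
  isomorphic X Y -> isomorphic Y Z -> isomorphic X Z.
Proof. by move=> [f fi] [g gi]; exists (g \c f); apply: is_iso_comp. Qed.
End Isomorphisms.

Lemma fmap_iso (C D : category) (F : functor C D) (X Y : C) (f : hom X Y) :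
  is_iso f -> is_iso (fmap F f).
Proof. by move=> [g gf fg]; exists (fmap F g); rewrite -fmapM ?gf ?fg fmap1. Qed.

Lemma fmap_isomorphic (C D : category) (F : functor C D) (X Y : C) :
  isomorphic X Y -> isomorphic (F X) (F Y).
Proof. by move=> [f fi]; exists (fmap F f); apply: fmap_iso. Qed.

Lemma fully_faithful_equivalence (C D : category) (F : functor C D) :
  fully_faithful F -> (forall Y, exists X, isomorphic (F X) Y) ->
  is_equivalence F.
Proof.
move=> ff es.
(* Bijectivity is recast as an existential, from which [cid] extracts the inverse. *)
have {}ff X Y : exists g : hom (F X) (F Y) -> hom X Y,
    cancel (@fmap C D F X Y) g /\ cancel g (@fmap C D F X Y).
  by have [g gK Kg] := ff X Y; exists g.
pose inv_ X Y := sval (cid (ff X Y)).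
have invK X Y (f : hom X Y) : inv_ X Y (fmap F f) = f.
  exact: (svalP (cid (ff X Y))).1.
have Kinv X Y f : fmap F (inv_ X Y f) = f by exact: (svalP (cid (ff X Y))).2.
pose q Y := sval (cid (es Y)).
pose e Y : hom (F (q Y)) Y := sval (cid (svalP (cid (es Y)))).
have ei Y : is_iso (e Y) by exact: (svalP (cid (svalP (cid (es Y))))).
have {}ei Y : exists g, g \c e Y = idm _ /\ e Y \c g = idm _.
  by have [g ge eg] := ei Y; exists g.
pose d Y := sval (cid (ei Y)).
have de Y : d Y \c e Y = idm _ by exact: (svalP (cid (ei Y))).1.
have ed Y : e Y \c d Y = idm _ by exact: (svalP (cid (ei Y))).2.
have inj X Y (f g : hom X Y) : fmap F f = fmap F g -> f = g.
  by move=> fg; rewrite -(invK _ _ f) fg invK.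
pose qm Y Y' (f : hom Y Y') := inv_ (q Y) (q Y') (d Y' \c (f \c e Y)).
have qm1 Y : qm Y Y (idm Y) = idm _ by apply: inj; rewrite Kinv fmap1 comp1m de.
have qmM X Y Z (g : hom Y Z) (f : hom X Y) :
    qm X Z (g \c f) = qm Y Z g \c qm X Y f.
  apply: inj; rewrite fmapM !Kinv -!compA; congr (_ \c (_ \c _)).
  by rewrite !compA ed comp1m.
pose Q : functor D C := Functor qm1 qmM.
have bN X Y (f : hom X Y) :
    e Y \c fmap (fcomp F Q) f = fmap (idF D) f \c e X.
  by rewrite /= Kinv !compA ed comp1m.
pose b : nattrans (fcomp F Q) (idF D) :=
  @NatTrans D D (fcomp F Q) (idF D) e bN.
have aN X Y (f : hom X Y) : inv_ (q (F Y)) Y (e (F Y)) \c fmap (fcomp Q F) f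
    = fmap (idF C) f \c inv_ (q (F X)) X (e (F X)).
  by apply: inj; rewrite /= !fmapM !Kinv !compA ed comp1m.
pose a : nattrans (fcomp Q F) (idF C) :=
  @NatTrans C C (fcomp Q F) (idF C) (fun X => inv_ (q (F X)) X (e (F X))) aN.
exists Q, a, b; split=> X; last by exists (d X); [exact: de | exact: ed].
exists (inv_ X (q (F X)) (d (F X))); apply: inj.
- by rewrite fmapM !Kinv de fmap1.
- by rewrite fmapM !Kinv ed fmap1.
Qed.

Section Triangulated.
Variable S : tricat.
Implicit Types X Y Z W : S.

Let ax : is_triangulated S := tc_axioms S.

(** The preimage is [fmap loop c] conjugated by the counits; naturality of the unit and the triangle
    identities bring it back to [c]. *)
Lemma sus_full X Y (c : hom X[+1] Y[+1]) : exists g : hom X Y, fmap sus g = c.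
Proof.
have [k kc ck] := @loop_sus_counit_iso S X.
exists (adj_counit loop_sus Y \c fmap loop c \c k).
have -> : fmap sus (adj_counit loop_sus Y \c fmap loop c \c k) =
    fmap sus (adj_counit loop_sus Y) \c (fmap sus (fmap loop c) \c fmap sus k).
  by rewrite !fmapM compA.
(* A triangle identity makes [fmap sus] of the counit a left inverse of the invertible unit at
   [X[+1]], hence equal to its inverse [l]. *)
have -> : fmap sus k = adj_unit loop_sus X[+1].
  have [l l1 l2] := @loop_sus_unit_iso S X[+1].
  have triR := adj_triR (@loop_sus S) X.
  have el : fmap sus (adj_counit loop_sus X) = l.
    by rewrite -[LHS]compm1 -l2 compA triR comp1m.
  by rewrite -[LHS]comp1m -l2 -el -compA -fmapM ck fmap1 compm1.
rewrite loop_sus_unit_nat compA.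
by have -> := adj_triR (@loop_sus S) Y; rewrite comp1m.
Qed.
Lemma hom_from_zero X Y (f : hom X Y) : is_zero_ob X -> f = 0.
Proof. by move=> X0; rewrite -[f]compm1 X0 compm0. Qed.

Lemma hom_to_zero X Y (f : hom X Y) : is_zero_ob Y -> f = 0.
Proof. by move=> Y0; rewrite -[f]comp1m Y0 comp0m. Qed.

Lemma zero_ob_sus X : is_zero_ob X -> is_zero_ob X[+1].
Proof. by rewrite /is_zero_ob -fmap1 => ->; rewrite sus0. Qed.

Lemma sus_reflect_isomorphic X Y : isomorphic X[+1] Y[+1] -> isomorphic X Y.
Proof.
move=> [f [g]]; have [f' <-] := sus_full f; have [g' <-] := sus_full g.
by rewrite -!fmapM -!fmap1 => /sus_faithful gf /sus_faithful fg; exists f', g'.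
Qed.

Lemma sus_loop_isomorphic X : isomorphic X X[-1][+1].
Proof. by exists (adj_unit loop_sus X); apply: loop_sus_unit_iso. Qed.

Lemma loop_sus_isomorphic X : isomorphic X[+1][-1] X.
Proof. by exists (adj_counit loop_sus X); apply: loop_sus_counit_iso. Qed.

Lemma loop_reflect_zero X Y (f : hom X Y) : fmap loop f = 0 -> f = 0.
Proof.
move=> f0; have := loop_sus_unit_nat f; rewrite f0 sus0 comp0m => E.
have [l l1 l2] := @loop_sus_unit_iso S Y.
by rewrite -[f]comp1m -l1 -compA -E compm0.
Qed.

Section Triangle.
Variables (X Y Z : S) (u : hom X Y) (v : hom Y Z) (w : hom Z X[+1]).
Hypothesis uvw : dist u v w.

Lemma dist_comp0 : v \c u = 0.
Proof.
have [O O0] := has_zero_ob ax.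
have [|c [cv _]] :=
  dist_mor ax (a := idm X) (b := u) (dist_id ax X O0) uvw; first by [].
by rewrite -cv (hom_from_zero c O0) comp0m.
Qed.

Lemma dist_weak_cokernel W (f : hom Y W) :
  f \c u = 0 -> exists g : hom Z W, f = g \c v.
Proof.
move=> fu; have [O O0] := has_zero_ob ax.
have d0 : dist (0 : hom O W) (idm W) (0 : hom W O[+1]).
  apply/(dist_rot ax); rewrite sus0 oppr0.
  exact/(dist_id ax)/zero_ob_sus.
have [|g [gv _]] := dist_mor ax (a := (0 : hom X O)) (b := f) uvw d0.
  by rewrite fu comp0m.
by exists g; rewrite gv comp1m.
Qed.

(** The pair [(f, 0)] extends to a morphism from [W -> O -> W[1]] to the rotated triangle [Y -> Z ->
    X[1]]; its third component desuspends by fullness of [sus]. *)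
Lemma dist_weak_kernel W (f : hom W Y) :
  v \c f = 0 -> exists g : hom W X, f = u \c g.
Proof.
move=> vf; have [O O0] := has_zero_ob ax.
have /(dist_rot ax) d0 := dist_id ax W O0.
have /(dist_rot ax) vwu := uvw.
have [|c [_]] := dist_mor ax (a := f) (b := (0 : hom O Z)) d0 vwu.
  by rewrite vf comp0m.
have [g <-] := sus_full c; rewrite fmap1 compNr compm1 compNl -fmapM.
by move=> /oppr_inj /sus_faithful; exists g.
Qed.
End Triangle.

Lemma dist_rot_inv Y Z X (v : hom Y Z) (w : hom Z X) (x : hom X Y[+1]) :
  dist v w x -> exists (u : hom X[-1] Y) (w' : hom Z X[-1][+1]), dist u v w'.
Proof.
move=> vwx; have [l l1 l2] := @loop_sus_unit_iso S X.
(* The sign cancels the one introduced by [dist_rot]; [l] undoes the replacement of [X] by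
   [X[-1][+1]]. *)
have [u uE] := sus_full (- (x \c l)).
exists u, (adj_unit loop_sus X \c w); apply/(dist_rot ax).
apply: (dist_iso ax (iso_id Y) (iso_id Z) (@loop_sus_unit_iso S X)) vwx.
- by rewrite comp1m compm1.
- by rewrite compm1.
- by rewrite fmap1 comp1m uE opprK -compA l1 compm1.
Qed.

Lemma dist_fiber Y Z (v : hom Y Z) :
  exists X (u : hom X Y) (w : hom Z X[+1]), dist u v w.
Proof.
have [X [w [x vwx]]] := dist_cone ax v.
by have [u [w' d]] := dist_rot_inv vwx; exists X[-1], u, w'.
Qed.

Lemma iso_of_bij X Y (f : hom X Y) :
  (forall W (g : hom W X), f \c g = 0 -> g = 0) ->
  (exists g : hom Y X, f \c g = idm Y) -> is_iso f.
Proof.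
move=> inj [g fg]; exists g => //; apply/eqP; rewrite -subr_eq0; apply/eqP.
by apply: inj; rewrite compDr compNr compA fg comp1m compm1 subrr.
Qed.

(* Exactness of a triangle is only required after [Hom(W, -)], since colimits
   of triangles are not known to be distinguished. *)
Lemma five_lemma X Y Z Z' (u : hom X Y) (v : hom Y Z) (w : hom Z X[+1])
    (v' : hom Y Z') (w' : hom Z' X[+1]) (c : hom Z Z') :
  dist u v w -> c \c v = v' -> w' \c c = w -> 
  fmap sus u \c w' = 0 ->
  (forall W (f : hom W Z'), w' \c f = 0 -> exists g, f = v' \c g) ->
  (forall W (f : hom W Y), v' \c f = 0 -> exists g, f = u \c g) ->
  is_iso c.
Proof.
move=> uvw cv w'c uw' exZ exY.
have vu := dist_comp0 uvw.
have /(dist_rot ax) vwu := uvw.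
have /(dist_rot ax) wuv := vwu.
apply: iso_of_bij => [W g cg|].
  (* If [c] kills [g], then [g] is [v \c k] with [k] coming from [X], so [g] vanishes. *)
  have wg : w \c g = 0 by rewrite -w'c -compA cg compm0.
  have [k gE] := dist_weak_kernel vwu wg.
  have [|l kE] := exY _ k; first by rewrite -cv -compA -gE.
  by rewrite gE kE compA vu comp0m.
(* Lifting [w'] through [w] gives [g]. As [w'] kills [idm Z' - c \c g], this difference is
   [v' \c k], and [v \c k + g] is a section of [c]. *)
have [|g gE] := dist_weak_kernel wuv (f := w') _; first by rewrite compNl uw' oppr0.
have [|k kE] := exZ _ (idm Z' - c \c g).
  by rewrite compDr compNr compm1 compA w'c -gE subrr.
by exists (v \c k + g); rewrite compDr compA cv -kE subrK.
Qed.

(** Transporting the second triangle along [a] and [b] reduces to a morphism that is the identity on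
    [X] and [Y], where the five lemma applies. *)
Lemma dist_mor_iso X Y Z X' Y' Z'
    (u : hom X Y) (v : hom Y Z) (w : hom Z X[+1])
    (u' : hom X' Y') (v' : hom Y' Z') (w' : hom Z' X'[+1])
    (a : hom X X') (b : hom Y Y') (c : hom Z Z') :
  dist u v w -> dist u' v' w' -> is_iso a -> is_iso b ->
  b \c u = u' \c a -> c \c v = v' \c b -> fmap sus a \c w = w' \c c ->
  is_iso c.
Proof.
move=> d d' [a' a'a aa'] [b' b'b bb'] bu cv aw.
have d'' : dist u (v' \c b) (fmap sus a' \c w').
  apply: (dist_iso ax (a := a') (b := b') (c := idm Z')) d'.
  - by exists a.
  - by exists b.
  - exact: iso_id.
  - by rewrite -[u]comp1m -b'b -(compA b') bu -!compA aa' compm1.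
  - by rewrite comp1m -compA bb' compm1.
  - by rewrite compm1.
have /(dist_rot ax) r := d''; have /(dist_rot ax) r2 := r.
apply: (five_lemma d cv (w' := fmap sus a' \c w')).
- by rewrite -compA -aw compA -fmapM a'a fmap1 comp1m.
- by apply: oppr_inj; rewrite -compNl (dist_comp0 r2) oppr0.
- by move=> W f /(dist_weak_kernel r).
- by move=> W f /(dist_weak_kernel d'').
Qed.

(** After one rotation the missing component becomes the third one; the resulting isomorphism of
    suspensions is then desuspended. *)
Lemma dist_isomorphic_first X Y Z X' Y' Z'
    (u : hom X Y) (v : hom Y Z) (w : hom Z X[+1])
    (u' : hom X' Y') (v' : hom Y' Z') (w' : hom Z' X'[+1])
    (b : hom Y Y') (c : hom Z Z') :
  dist u v w -> dist u' v' w' -> is_iso b -> is_iso c ->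
  c \c v = v' \c b -> isomorphic X X'.
Proof.
move=> /(dist_rot ax) d /(dist_rot ax) d' bi ci cv.
have [a [aw au]] := dist_mor ax d d' cv.
by apply: sus_reflect_isomorphic; exists a; apply: (dist_mor_iso d d' bi ci).
Qed.
End Triangulated.

(** * Aisles *)

Definition orth (C : preadd) (X Y : C) : Prop := forall f : hom X Y, f = 0.

Section Orthogonality.
Variable S : tricat.
Implicit Types X Y Z W : S.

Lemma orth_isomorphic X X' Y Y' :
  isomorphic X X' -> isomorphic Y Y' -> orth X Y -> orth X' Y'.
Proof.
move=> [a [a' _ aa']] [b [b' _ bb']] XY f.
have -> : f = b \c (b' \c f \c a) \c a'.
  by rewrite !compA bb' comp1m -compA aa' compm1.
by rewrite (XY (b' \c f \c a)) compm0 comp0m.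
Qed.

Lemma orth_ext X Y Z W (u : hom X Y) (v : hom Y Z) (w : hom Z X[+1]) :
  dist u v w -> orth X W -> orth Z W -> orth Y W.
Proof.
move=> uvw XW ZW f; have [g ->] := dist_weak_cokernel uvw (XW (f \c u)).
by rewrite (ZW g) comp0m.
Qed.

Lemma orth_extr X Y Z W (u : hom X Y) (v : hom Y Z) (w : hom Z X[+1]) :
  dist u v w -> orth W X -> orth W Z -> orth W Y.
Proof.
move=> uvw WX WZ f; have [g ->] := dist_weak_kernel uvw (WZ (v \c f)).
by rewrite (WX g) compm0.
Qed.

Lemma orth_summand X Y Z W : is_dirsum X Y Z -> orth Z W -> orth X W.
Proof.
move=> [i1 [_ [p1 [_ [e _ _ _ _]]]]] ZW f.
by rewrite -[f]compm1 -e compA (ZW (f \c p1)) comp0m.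
Qed.

Lemma orth_sus X Y : orth X Y -> orth X[+1] Y[+1].
Proof. by move=> XY f; have [g <-] := sus_full f; rewrite (XY g) sus0. Qed.

Lemma orth_loopr X Y : orth X[+1] Y -> orth X Y[-1].
Proof.
move=> XY f; apply: sus_faithful; rewrite sus0.
exact: orth_isomorphic (isomorphic_refl _) (sus_loop_isomorphic Y) XY _.
Qed.

Lemma orth_loopl X Y : orth X Y[-1] -> orth X[+1] Y.
Proof.
move=> /orth_sus; apply: orth_isomorphic; first exact: isomorphic_refl.
exact/isomorphic_sym/sus_loop_isomorphic.
Qed.

Lemma sus_iterSr n X : sus_iter n X[+1] = (sus_iter n X)[+1].
Proof. by elim: n => //= n ->. Qed.

Lemma loop_iterSr n X : loop_iter n X[-1] = (loop_iter n X)[-1].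
Proof. by elim: n => //= n ->. Qed.

Lemma sus_iterD m n X : sus_iter (m + n) X = sus_iter m (sus_iter n X).
Proof. by elim: m => //= m ->. Qed.

Lemma sus_iter_isomorphic n X Y :
  isomorphic X Y -> isomorphic (sus_iter n X) (sus_iter n Y).
Proof. by move=> XY; elim: n => //= n; apply: fmap_isomorphic. Qed.

Lemma loop_iterK n X : isomorphic (sus_iter n (loop_iter n X)) X.
Proof.
elim: n => [|n IH]; first exact: isomorphic_refl.
rewrite /= -sus_iterSr; apply: isomorphic_trans IH.
exact/sus_iter_isomorphic/isomorphic_sym/sus_loop_isomorphic.
Qed.

Lemma orth_sus_iter n X Y : orth X Y -> orth (sus_iter n X) (sus_iter n Y).
Proof. by move=> XY; elim: n => //= n; apply: orth_sus. Qed.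

Lemma orth_loop_iterr n X Y : orth (sus_iter n X) Y -> orth X (loop_iter n Y).
Proof.
by elim: n X => //= n IH X XY; apply/orth_loopr/IH; rewrite sus_iterSr.
Qed.

Lemma dirsum_sym X Y Z : is_dirsum X Y Z -> is_dirsum Y X Z.
Proof.
move=> [i1 [i2 [p1 [p2 [e1 e2 e3 e4 e5]]]]].
by exists i2, i1, p2, p1; split; rewrite // addrC.
Qed.

Lemma gen_le_summand G H X n i : is_dirsum H X G -> (n <= i)%N ->
  gen_le G n (sus_iter i H).
Proof.
move=> d ni; apply: gle_summand (gle_base G ni).
suff : is_dirsum (sus_iter i H) (sus_iter i X) (sus_iter i G) by exact.
by elim: i {ni} => // i; apply: dirsum_sus.
Qed.

Lemma gen_le_sus_iter G m n X : gen_le G n X -> gen_le G n (sus_iter m X).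
Proof. by move=> XG; elim: m => //= m; apply: gen_le_sus. Qed.

Lemma gen_le_susS G n X : gen_le G n X -> gen_le G n.+1 X[+1].
Proof.
elim=> [i ni|A B D u v w uvw _ IA _ ID|A B D dAB _ ID].
- exact: (@gle_base S G n.+1 i.+1).
- exact: (gle_ext (dist_sus uvw)).
- exact: (gle_summand (dirsum_sus dAB)).
Qed.

Lemma gen_le_susD G m n X : gen_le G n X -> gen_le G (m + n) (sus_iter m X).
Proof. by move=> XG; elim: m => //= m; apply: gen_le_susS. Qed.

Lemma gen_le_loopD G m n X : gen_le G (m + n) X -> gen_le G n (loop_iter m X).
Proof.
elim: m n => //= m IH n; rewrite addSnnS => /IH; exact: gen_le_loop.
Qed.

Lemma gen_le_trans G H n X :
  (forall i, (n <= i)%N -> gen_le G n (sus_iter i H)) ->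
  gen_le H n X -> gen_le G n X.
Proof.
move=> GH; elim=> [i /GH //|A B D u v w uvw _ IA _ ID|A B D dAB _ ID].
- exact: gle_ext uvw IA ID.
- exact: gle_summand dAB ID.
Qed.

Lemma gen_le_zero G n Z : is_zero_ob Z -> gen_le G n Z.
Proof.
move=> Z0; apply: gle_summand (@gle_base S G n n (leqnn n)).
exists 0, (idm (shift n G)), 0, (idm (shift n G)).
by split; rewrite ?comp0m ?compm0 ?comp1m ?add0r // Z0.
Qed.
End Orthogonality.

Section Aisles.
Variable S : tricat.
Implicit Types (X Y Z W : S) (U : S -> Prop).

Let ax : is_triangulated S := tc_axioms S.

Definition coaisle U Y : Prop := forall X, U X -> orth X Y.

Record aisle U : Prop := Aisle {
  aisle_summand : forall X Y Z, is_dirsum X Y Z -> U Z -> U X;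
  aisle_ext : forall X Y Z (u : hom X Y) (v : hom Y Z) (w : hom Z X[+1]),
    dist u v w -> U X -> U Z -> U Y;
  aisle_sus : forall X, U X -> U X[+1];
  aisle_trunc : forall X, exists A B (u : hom A X) (v : hom X B)
    (w : hom B A[+1]), [/\ U A, coaisle U B & dist u v w] }.

Record bounded_aisle U : Prop := BoundedAisle {
  bounded_is_aisle :> aisle U;
  bounded_above : forall X, exists m, U (sus_iter m X);
  bounded_below : forall X, exists m, forall A, U A -> orth (sus_iter m A) X }.

Definition generated_by U (G : S) : Prop :=
  exists c, forall X, U X -> gen_le G 0 (sus_iter c X).

Lemma aisle_isomorphic U X Y : aisle U -> isomorphic X Y -> U X -> U Y.
Proof.
move=> aU XY; have [O O0] := has_zero_ob ax.
exact/(aisle_summand aU)/(dirsum_zero (isomorphic_sym XY) O0).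
Qed.

Lemma aisle_sus_iter U n X : aisle U -> U X -> U (sus_iter n X).
Proof. by move=> aU UX; elim: n => //= n; apply: aisle_sus. Qed.

(** This class is the shift [U[1]]: the truncation triangle of [X[-1]], suspended and transported
    along the unit, truncates [X]. *)
Lemma aisle_loop U : aisle U -> aisle (fun X => U X[-1]).
Proof.
move=> aU; split=> [X Y Z /dirsum_loop|X Y Z u v w d|X|X].
- exact: aisle_summand.
- by have [w' d'] := dist_loop d; apply: (aisle_ext aU d').
- move=> /(aisle_sus aU); apply: aisle_isomorphic => //.
  apply: isomorphic_trans (isomorphic_sym (loop_sus_isomorphic X)).
  exact/isomorphic_sym/sus_loop_isomorphic.
- have [A [B [u [v [w [UA UB uvw]]]]]] := aisle_trunc aU X[-1].
  have [l l1 l2] := @loop_sus_unit_iso S X.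
  exists A[+1], B[+1], (l \c fmap sus u), (fmap sus v \c adj_unit loop_sus X),
    (- fmap sus w).
  split.
  + exact: aisle_isomorphic aU (isomorphic_sym (loop_sus_isomorphic A)) UA.
  + move=> Y UY; apply: orth_isomorphic (isomorphic_sym (sus_loop_isomorphic Y))
      (isomorphic_refl _) _.
    exact/orth_sus/UB.
  + apply: (dist_iso ax (iso_id _) (b := l) _ (iso_id _) _ _ _ (dist_sus uvw)).
    * by exists (adj_unit loop_sus X).
    * by rewrite compm1.
    * by rewrite comp1m -compA l2 compm1.
    * by rewrite fmap1 comp1m compm1.
Qed.

Lemma aisle_loop_iter U n : aisle U -> aisle (fun X => U (loop_iter n X)).
Proof.
move=> aU; elim: n => //= n IH.
(* [aisle_loop] inserts the new [loop] innermost, while [loop_iter] adds it outermost. *)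
suff -> : (fun X => U (loop_iter n X)[-1]) = (fun X => U (loop_iter n X[-1])).
  exact: (aisle_loop IH).
by apply: funext => X; rewrite loop_iterSr.
Qed.
End Aisles.

(** * Generated bounded aisles from t-structures and finitistic dimension *)

Section TStructures.
Variables (R : tricat) (t : tstructure R).
Implicit Types X Y : R.

(* The class [t_le0 t], presented so that closure properties are immediate. *)
Definition taisle X : Prop := forall Y, t_ge1 t Y -> orth X Y.

Lemma taisle_aisle : aisle taisle.
Proof.
split=> [X Y Z d UZ W W1|X Y Z u v w d UX UZ W W1|X UX W W1|X].
- exact: orth_summand d (UZ W W1).
- exact: orth_ext d (UX W W1) (UZ W W1).
- by apply/orth_loopl/UX/t_ge1_shift.
- have [A [B [u [v [w [A0 B1 d]]]]]] := t_trunc t X.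
  exists A, B, u, v, w; split=> // [Y Y1 f|Y UY]; last exact: UY.
  exact: t_orth A0 Y1.
Qed.

Lemma taisle_bounded : t_bounded t -> bounded_aisle taisle.
Proof.
move=> [above below]; split=> [|X|X]; first exact: taisle_aisle.
(* The bound is positive, and for a successor the shift by its opposite computes to
   [loop_iter m.+1]. *)
- have [[//|m] _ [Y Y0 XY]] := above X; exists m.+1.
  apply: (@aisle_isomorphic R _ Y _ taisle_aisle); last first.
    by move=> W W1 f; apply: t_orth f Y0 W1.
  apply: isomorphic_sym.
  exact: isomorphic_trans (sus_iter_isomorphic m.+1 XY) (loop_iterK m.+1 Y).
- have [m _ [Y Y1 XY]] := below X; exists m => A UA.
  apply: orth_isomorphic (isomorphic_refl _) (isomorphic_sym XY) _.
  exact/orth_sus_iter/UA.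
Qed.
End TStructures.

Section FiniteFinitisticDimension.
Variable R : tricat.
Implicit Types X Y G : R.

Lemma op_sus_iter n X : @sus_iter (op_tri R) n X = @loop_iter R n X.
Proof. by elim: n => //= n ->. Qed.

(** Passing to the opposite category reverses triangles, exchanges injections with projections, and
    turns negative shifts into suspensions. *)
Lemma op_gen_nonneg G X : @gen_nonneg (op_tri R) G X -> gen_le G 0 X.
Proof.
elim=> [|A B D u v w d _ IA _ ID|A B D [i1 [i2 [p1 [p2 [e1 e2 e3 e4 e5]]]]] _ ID|A _].
- exact: (@gle_base R G 0 0).
- exact: (@gle_ext R G 0 _ _ _ v u _ d ID IA).
- by apply: gle_summand ID; exists p1, p2, i1, i2; split.
- exact: gen_le_sus.
Qed.

Lemma findim_generated U :
  findim_finite (op_tri R) -> bounded_aisle U -> exists G, generated_by U G.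
Proof.
move=> [G [n nG]] bU; exists (G : R).
have [m mG] := bounded_below bU (G : R).
(* The shift by [m] moves [X] into the orthogonal that the finitistic dimension controls; the shift
   by [n] undoes the one that its definition allows. *)
exists (n + m)%N => X UX.
have [|Y /op_gen_nonneg YG XY] := nG (sus_iter m X).
  move=> k _; suff : orth (sus_iter m X) (@loop_iter R k G).
    by rewrite -op_sus_iter.
  (* Maps from [X[m]] to [G[-k]] become maps from [X[k][m]] to [G], and [X[k]] still lies in [U]. *)
  apply: orth_loop_iterr; rewrite -sus_iterD addnC sus_iterD.
  move=> f; apply: mG (aisle_sus_iter k (bounded_is_aisle bU) UX) f.
have {}XY : isomorphic (sus_iter m X) (@loop_iter R n Y).
  by move: XY; rewrite -op_sus_iter => -[f [g gf fg]]; exists g, f.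
rewrite sus_iterD; apply: gen_le_iso YG.
exact: isomorphic_trans (sus_iter_isomorphic n XY) (@loop_iterK R n Y).
Qed.
End FiniteFinitisticDimension.

(** * Gluing aisles along a recollement *)

Section TriangleFunctor.
Variables (S T : tricat) (F : trifunctor (sh_of S) (sh_of T)).
Implicit Types X Y Z : S.

Lemma tri_fmapD X Y (f g : hom X Y) :
  fmap F (f + g : hom X Y) = fmap F f + fmap F g :> phom (F X) (F Y).
Proof. exact: (tf_add F). Qed.

Lemma tri_fmap0 X Y : fmap F (0 : hom X Y) = 0 :> phom (F X) (F Y).
Proof. by apply: (addrI (fmap F (0 : hom X Y))); rewrite -tri_fmapD !addr0. Qed.

Lemma tri_dirsum X Y Z : is_dirsum X Y Z -> @is_dirsum T (F X) (F Y) (F Z).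
Proof.
move=> [i1 [i2 [p1 [p2 [e1 e2 e3 e4 e5]]]]].
exists (fmap F i1), (fmap F i2), (fmap F p1), (fmap F p2).
split.
- by rewrite -[RHS](fmap1 F X) -e1; symmetry; apply: fmapM.
- by rewrite -[RHS](fmap1 F Y) -e2; symmetry; apply: fmapM.
- by rewrite -[RHS]tri_fmap0 -e3; symmetry; apply: fmapM.
- by rewrite -[RHS]tri_fmap0 -e4; symmetry; apply: fmapM.
- rewrite -[RHS](fmap1 F Z) -[in RHS]e5 tri_fmapD.
  by congr (_ + _); [exact: esym (fmapM F i1 p1) | exact: esym (fmapM F i2 p2)].
Qed.

Lemma tri_dist X Y Z (u : hom X Y) (v : hom Y Z) (w : hom Z X[+1]) :
  dist u v w -> exists w', @dist T (F X) (F Y) (F Z) (fmap F u) (fmap F v) w'.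
Proof. by move=> /(tf_dist F) d; eexists; exact: d. Qed.

Lemma tri_sus X : @isomorphic T (F X[+1]) (sus (F X : T)).
Proof. by exists (tf_shift F X); exact: (tf_shift_iso F X). Qed.

Lemma tri_sus_iter n X : @isomorphic T (F (sus_iter n X)) (sus_iter n (F X : T)).
Proof.
elim: n => [|n IH]; first exact: isomorphic_refl.
exact: isomorphic_trans (tri_sus _) (fmap_isomorphic sus IH).
Qed.

Lemma tri_gen_le G n X : gen_le G n X -> @gen_le T (F G) n (F X).
Proof.
elim=> [i ni|A B D u v w d _ IA _ ID|A B D d _ ID].
- apply: gen_le_iso (tri_sus_iter i G) _.
  exact: (@gle_base T (F G) n i ni).
- have [w' d'] := tri_dist d; exact: (gle_ext d').
- exact: (@gle_summand T _ n _ _ _ (tri_dirsum d)).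
Qed.
End TriangleFunctor.

Section Adjoint.
Variables (S T : tricat).
Variables (L : trifunctor (sh_of S) (sh_of T)) (P : trifunctor (sh_of T) (sh_of S)).
Variable adj : adjunction L P.

(** A map into [P N] is recovered from its adjunct [L X -> N], which is zero. *)
Lemma orth_adjoint (X : S) (N : T) : @orth T (L X) N -> @orth S X (P N).
Proof.
move=> LX f.
have E : adj_counit adj N \c fmap L f = (0 : phom (L X) N) by exact: LX.
have nf : fmap P (fmap L f) \c adj_unit adj X = adj_unit adj (P N) \c f.
  by symmetry; exact: (nnat (adj_unit adj) f).
have -> : f = fmap P (adj_counit adj N) \c (adj_unit adj (P N) \c f).
  by rewrite compA; have -> := adj_triR adj N; rewrite comp1m.
rewrite -nf compA -fmapM E; have -> := tri_fmap0 P (L X) N; exact: comp0m.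
Qed.

Hypothesis Pff : fully_faithful P.

(** The inverse is the preimage under [P] of the unit at [P N]; the two composites are computed by
    the two triangle identities. *)
Lemma counit_iso (N : T) : is_iso (adj_counit adj N).
Proof.
have [g gK Kg] := Pff N (L (P N)).
have inj X Y (a b : hom X Y) : fmap P a = fmap P b -> a = b.
  by have [h hK _] := Pff X Y => ab; rewrite -(hK a) ab hK.
have cg : adj_counit adj N \c g (adj_unit adj (P N)) = idm N.
  by apply: inj; rewrite fmapM Kg fmap1; exact: adj_triR.
exists (g (adj_unit adj (P N))) => //.
have n1 : adj_counit adj (L (P N)) \c fmap L (fmap P (g (adj_unit adj (P N))))
    = g (adj_unit adj (P N)) \c adj_counit adj N.
  exact: (nnat (adj_counit adj) (g (adj_unit adj (P N)))).
by rewrite -n1 Kg; exact: (adj_triL adj (P N)).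
Qed.

(** [Y] is the fiber of the adjunct [X -> P N] of the truncation map [L X -> N]. Applying [L] and
    the invertible counit at [N] recovers the truncation triangle of [L X], so [L Y] is isomorphic
    to [A]. *)
Lemma aisle_pull_fiber (U : T -> Prop) (X : S) : aisle U ->
  exists (Y : S) (N : T) (u : hom Y X) (v : hom X (P N)) (w : hom (P N : S) Y[+1]),
    [/\ U (L Y), coaisle U N & @dist S _ _ _ u v w].
Proof.
move=> aU; have [A [N [u [v [w [UA UN uvw]]]]]] := aisle_trunc aU (L X : T).
pose g : hom X (P N) := fmap P v \c adj_unit adj X.
have [Y [y [z d]]] := @dist_fiber S _ _ g.
exists Y, N, y, g, z; split=> //.
have [z' d'] := tri_dist L d.
have E : adj_counit adj N \c fmap L g = v.
  rewrite fmapM compA.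
  have -> : adj_counit adj N \c fmap L (fmap P v) = v \c adj_counit adj (L X).
    exact: (nnat (adj_counit adj) v).
  by rewrite -compA; have -> := adj_triL adj X; exact: compm1.
apply: (@aisle_isomorphic T U A _ aU) UA.
apply/isomorphic_sym/(dist_isomorphic_first d' uvw (@iso_id T _)).
  exact: counit_iso.
by rewrite compm1; exact: E.
Qed.
End Adjoint.

Section Recollement.
Variables (R S T : tricat) (rec : recollement R S T).
Variables (UR : R -> Prop) (UT : T -> Prop).

Definition glued (X : S) : Prop := UT (j_pull rec X) /\ UR (i_pull rec X).

Lemma glued_coaisle_i N : coaisle UR N -> coaisle glued (i_push rec N).
Proof. by move=> N0 X [_ UX]; apply: (orth_adjoint (adj_ipull rec)); exact: N0. Qed.

Lemma glued_coaisle_j N : coaisle UT N -> coaisle glued (j_push rec N).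
Proof. by move=> N0 X [UX _]; apply: (orth_adjoint (adj_jpush rec)); exact: N0. Qed.

Lemma glued_aisle : aisle UR -> aisle UT -> aisle glued.
Proof.
move=> aR aT; split.
- move=> X Y Z d [ZT ZR]; split.
  + exact: (aisle_summand aT (tri_dirsum (j_pull rec) d)).
  + exact: (aisle_summand aR (tri_dirsum (i_pull rec) d)).
- move=> X Y Z u v w d [XT XR] [ZT ZR]; split.
  + have [w' d'] := tri_dist (j_pull rec) d; exact: (aisle_ext aT d').
  + have [w' d'] := tri_dist (i_pull rec) d; exact: (aisle_ext aR d').
- move=> X [XT XR]; split.
  + apply: (aisle_isomorphic aT (isomorphic_sym (tri_sus (j_pull rec) X))).
    exact: (@aisle_sus T UT aT _ XT).
  + apply: (aisle_isomorphic aR (isomorphic_sym (tri_sus (i_pull rec) X))).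
    exact: (@aisle_sus R UR aR _ XR).
move=> X.
(* Two successive truncations: first [X] along [j_pull], then the fiber [Y] along [i_pull]. *)
have [Y [M [g [p3 [d3 [UY UM dY]]]]]] :=
  aisle_pull_fiber (adj_jpush rec) (@j_push_ff _ _ _ rec) X aT.
have [A [N [f [p1 [d1 [UA UN dA]]]]]] :=
  aisle_pull_fiber (adj_ipull rec) (@i_push_ff _ _ _ rec) Y aR.
have [B [p2 [d2 dB]]] := dist_cone (tc_axioms S) (g \c f).
exists A, B, (g \c f), p2, d2; split=> //.
(* The second truncation leaves [j_pull] unchanged up to isomorphism, since [j_pull] kills the image
   of [i_push]. *)
- split=> //; have [z dz] := tri_dist (j_pull rec) dA.
  apply: (aisle_isomorphic aT (isomorphic_sym _) UY).
  have O0 := j_pull_i_push rec N.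
  apply: (dist_isomorphic_first dz (dist_id (tc_axioms T) _ O0) (iso_id _)
    (iso_id _)).
  by rewrite comp1m compm1 [LHS](hom_to_zero _ O0).
(* By the octahedral axiom, [B] is an extension of [j_push rec M] by [i_push rec N], both in the
   coaisle. *)
- have [a [b [dab _ _ _ _]]] := dist_oct (tc_axioms S) dA dB dY.
  by move=> W GW; apply: orth_extr dab (glued_coaisle_i UN GW) (glued_coaisle_j UM GW).
Qed.

Lemma glued_bounded :
  bounded_aisle UR -> bounded_aisle UT -> bounded_aisle glued.
Proof.
move=> bR bT; have aR := bounded_is_aisle bR; have aT := bounded_is_aisle bT.
split=> [|X|X]; first exact: glued_aisle.
- have [m mT] := bounded_above bT (j_pull rec X).
  have [n nR] := bounded_above bR (i_pull rec X).
  exists (n + m)%N; split.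
  + apply: (aisle_isomorphic aT (isomorphic_sym (tri_sus_iter _ _ X))).
    by rewrite sus_iterD; apply: aisle_sus_iter.
  + apply: (aisle_isomorphic aR (isomorphic_sym (tri_sus_iter _ _ X))).
    by rewrite addnC sus_iterD; apply: aisle_sus_iter.
- have [m mT] := bounded_below bT (j_pull rec X).
  have [n nR] := bounded_below bR (i_shriek rec X).
  exists (m + n)%N => A [AT AR].
  (* In this triangle both outer terms are images of right adjoints, so maps from shifts of [A]
     reduce to maps from shifts of [i_pull A] and [j_pull A]. *)
  have [w d] := recol_tri_push rec X.
  apply: orth_extr d _ _.
  + apply: (orth_adjoint (adj_ipull rec)).
    apply: orth_isomorphic (isomorphic_sym (tri_sus_iter _ _ A)) (isomorphic_refl _) _.
    by rewrite addnC sus_iterD; apply: nR; apply: aisle_sus_iter.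
  + apply: (orth_adjoint (adj_jpush rec)).
    apply: orth_isomorphic (isomorphic_sym (tri_sus_iter _ _ A)) (isomorphic_refl _) _.
    by rewrite sus_iterD; apply: mT; apply: aisle_sus_iter.
Qed.

(** The triangle with [j_shriek] is the suitable one here: its outer terms are images of [j_pull X]
    and [i_pull X], which membership in [glued] controls. The generators are joined in a direct sum,
    of which each is a summand. *)
Lemma glued_generated (GR : R) (GT : T) :
  generated_by UR GR -> generated_by UT GT -> exists G, generated_by glued G.
Proof.
move=> [cR gR] [cT gT].
have [G dG] := has_dirsum (tc_axioms S) (i_push rec GR) (j_shriek rec GT).
exists G, (cR + cT)%N => X [XT XR].
have [w d] := recol_tri_shriek rec (sus_iter (cR + cT) X).
apply: (gle_ext d).
- apply/(gen_le_trans (fun i => gen_le_summand (dirsum_sym dG)))/tri_gen_le.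
  apply: gen_le_iso (tri_sus_iter _ _ X) _.
  by rewrite sus_iterD; apply/gen_le_sus_iter/gT.
- apply/(gen_le_trans (fun i => gen_le_summand dG))/tri_gen_le.
  apply: gen_le_iso (tri_sus_iter _ _ X) _.
  by rewrite addnC sus_iterD; apply/gen_le_sus_iter/gR.
Qed.
End Recollement.

(** * Colimits of representable modules *)

(** The section [s] is kept because the action on a quotient module is defined through
    representatives. *)
Lemma zmod_quotient (V : zmodType) (N : V -> Prop) :
  N 0 -> (forall x y, N x -> N y -> N (x - y)) ->
  exists (Q : zmodType) (p : {additive V -> Q}) (s : Q -> V),
    cancel s p /\ forall x, p x = 0 <-> N x.
Proof.
move=> N0 NB.
pose A : V -> bool := fun x => `[<N x>].
have cl : zmod_closed A.
  split=> [|x y]; rewrite /A !unfold_in; first exact/asboolP.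
  by move=> /asboolP Nx /asboolP Ny; apply/asboolP/NB.
pose m := GRing.isZmodClosed.Build V A cl.
pose I : zmodClosed V := HB.pack A m.
pose q := Quotient.quot I.
have pA : zmod_morphism (\pi_q)%qT by move=> x y; exact: pi_is_zmod_morphism.
pose mp := GRing.isZmodMorphism.Build V q _ pA.
pose p : {additive V -> q} := HB.pack (\pi_q)%qT mp.
exists q, p, repr; split; first exact: reprK.
move=> x; rewrite -[0](raddf0 p); split=> [/eqP|Nx].
  by rewrite -[p x == _]Quotient.idealrBE subr0 => /asboolP.
by apply/eqP; rewrite -[p x == _]Quotient.idealrBE subr0; apply/asboolP.
Qed.

Section Modules.
Variable C : preadd.

Lemma act_0 (F : module C) (X Y : C) (x : fval F Y) : act F (0 : hom X Y) x = 0.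
Proof. by apply: (addrI (act F (0 : hom X Y) x)); rewrite -mod_add !addr0. Qed.

Lemma act_N (F : module C) (X Y : C) (f : hom X Y) (x : fval F Y) :
  act F (- f) x = - act F f x.
Proof. by apply/eqP; rewrite -addr_eq0 -mod_add addNr act_0. Qed.

(** Serves to build the test modules on which the universal property of a colimit is evaluated. *)
Lemma quotient_module (F : module C) (N : forall X, fval F X -> Prop) :
  (forall X, N X 0) -> (forall X x y, N X x -> N X y -> N X (x - y)) ->
  (forall X Y (f : hom X Y) x, N Y x -> N X (act F f x)) ->
  exists (Q : module C) (p : nattrans F Q),
    forall X (x : fval F X), nt_at p X x = 0 <-> N X x.
Proof.
move=> N0 NB NA.
have [Q QE] := choice (fun X => zmod_quotient (N0 X) (@NB X)).
pose p X := sval (cid (QE X)).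
have pE X : exists s, cancel s (p X) /\ forall x, p X x = 0 <-> N X x.
  exact: svalP (cid (QE X)).
pose s X := sval (cid (pE X)).
have sE X : cancel (s X) (p X) /\ forall x, p X x = 0 <-> N X x.
  exact: svalP (cid (pE X)).
(* Independence of the representative: the action respects classes modulo [N]. *)
have pq X Y (f : hom X Y) y y' : p Y y = p Y y' ->
    p X (act F f y) = p X (act F f y').
  move=> yy'; apply/eqP; rewrite -subr_eq0 -!raddfB; apply/eqP/(sE X).2/NA.
  by apply/(sE Y).2; rewrite raddfB yy' subrr.
have psK X x : p X (s X x) = x by apply: (sE X).1.
pose qa (Y X : C) (f : hom X Y) (x : Q Y) : Q X := p X (act F f (s Y x)).
have qaB Y X f : zmod_morphism (@qa Y X f).
  move=> x y; rewrite /qa -raddfB -raddfB; apply: pq.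
  by rewrite raddfB !psK.
pose qA Y X f : {additive Q Y -> Q X} :=
  HB.pack (@qa Y X f) (GRing.isZmodMorphism.Build _ _ _ (qaB Y X f)).
have qA1 X : qA X X (idm X) = idfun :> {additive Q X -> Q X}.
  apply: additive_ext => x.
  by rewrite -[LHS]/(p X (act F (idm X) (s X x))) act1 psK.
have qAM (X Y Z : opcat C) (g : hom Y Z) (f : hom X Y) :
    qA X Z (g \c f) = qA Y Z g \o qA X Y f :> {additive Q X -> Q Z}.
  apply: additive_ext => x.
  rewrite -[LHS]/(p Z (@act C F Z X (@comp C Z Y X f g) (s X x))).
  rewrite -[RHS]/(p Z (@act C F Z Y g (s Y (p Y (@act C F Y X f (s X x)))))).
  by rewrite actM; apply: pq; rewrite psK.
pose QF : functor (opcat C) Ab := @Functor (opcat C) Ab Q qA qA1 qAM.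
have qAD (X Y : C) (f g : hom X Y) (x : fval QF Y) :
    act QF (f + g) x = act QF f x + act QF g x.
  by rewrite -[LHS]/(p X (act F (f + g) (s Y x))) mod_add raddfD.
have pN X Y (f : hom X Y) (x : fval F Y) : p X (act F f x) = act QF f (p Y x).
  rewrite -[RHS]/(p X (act F f (s Y (p Y x)))).
  by apply: pq; rewrite psK.
exists (Module qAD), (@mk_nt C F QF p pN).
by move=> X x; exact: (sE X).2.
Qed.
End Modules.

Definition product (V : nat -> zmodType) : Type := forall j, V j.

HB.instance Definition _ (V : nat -> zmodType) := gen_eqMixin (product V).
HB.instance Definition _ (V : nat -> zmodType) := gen_choiceMixin (product V).

Section ProductZmod.
Variable V : nat -> zmodType.

Fact product_addA :
  associative (fun x y : product V => (fun j => x j + y j) : product V).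
Proof. by move=> x y z; apply: functional_extensionality_dep => j; apply: addrA. Qed.

Fact product_addC :
  commutative (fun x y : product V => (fun j => x j + y j) : product V).
Proof. by move=> x y; apply: functional_extensionality_dep => j; apply: addrC. Qed.

Fact product_add0 : left_id ((fun j => 0) : product V)
  (fun x y : product V => (fun j => x j + y j) : product V).
Proof. by move=> x; apply: functional_extensionality_dep => j; apply: add0r. Qed.

Fact product_addN : left_inverse ((fun j => 0) : product V)
  (fun x : product V => (fun j => - x j) : product V)
  (fun x y : product V => (fun j => x j + y j) : product V).
Proof. by move=> x; apply: functional_extensionality_dep => j; apply: addNr. Qed.

HB.instance Definition _ := GRing.isZmodule.Build (product V)
  product_addA product_addC product_add0 product_addN.
End ProductZmod.

Section Sequences.
Variables (S : tricat) (E : seqn S).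
Implicit Types X Y Z : S.

(* The transition map [E i -> E j] for [i <= j], and 0 otherwise. *)
Fixpoint tr (i j : nat) : hom (E i) (E j) :=
  match i =P j with
  | ReflectT e => ecast k (hom (E i) (E k)) e (idm (E i))
  | ReflectF _ =>
    match j return hom (E i) (E j) with
    | 0 => (0 : phom (E i) (E 0))
    | j'.+1 => sq_map E j' \c tr i j'
    end
  end.

Lemma tr_id i : tr i i = idm (E i).
Proof. by case: i => [|i] /=; case: eqP => // e; rewrite (eq_irrelevance e erefl). Qed.

Lemma trS i j : (i <= j)%N -> tr i j.+1 = sq_map E j \c tr i j.
Proof. by move=> ij /=; case: eqP => // e; rewrite e ltnn in ij. Qed.

Lemma tr_comp i j k : (i <= j)%N -> (j <= k)%N -> tr j k \c tr i j = tr i k.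
Proof.
move=> ij /subnK <-; elim: (k - j)%N => [|m IH]; first by rewrite tr_id comp1m.
rewrite addSn !trS ?leq_addl //; first by rewrite -compA IH.
exact: leq_trans ij (leq_addl _ _).
Qed.

Lemma sq_trans_tr i k : sq_trans E i k = tr i (k + i)%N.
Proof.
elim: k => [|k IH]; first by rewrite tr_id.
by rewrite -[RHS]/(tr i (k + i).+1) trS ?leq_addl // -IH.
Qed.

Lemma cauchy_tr G n : is_cauchy G E -> (1 <= n)%N -> exists N, forall i j,
  (N <= i)%N -> (i <= j)%N ->
  exists Z (v : hom (E j) Z) (w : hom Z (E i)[+1]),
    dist (tr i j) v w /\ gen_le G n Z.
Proof.
move=> cE n1; have [N EN] := cE n n1; exists N => i j Ni /subnK <-.
by rewrite -sq_trans_tr; apply: EN.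
Qed.

Definition product_module : module S.
Proof.
unshelve refine (@Module S (@Functor (opcat S) Ab
  (fun X => product (fun j => phom X (E j)))
  (fun X Y (f : @hom S Y X) => _ ) _ _) _).
- unshelve refine (HB.pack (fun (g : product (fun j => phom X (E j))) =>
    (fun j => @comp S Y X (E j) (g j) f) : product (fun j => phom Y (E j)))
    (GRing.isZmodMorphism.Build _ _ _ _)).
  by move=> g h; apply: functional_extensionality_dep => j; apply: precomp_is_additive.
- move=> X; apply: additive_ext => g; apply: functional_extensionality_dep => j.
  exact: (@pcompm1 S X (E j) (g j)).
- move=> X Y Z f g; apply: additive_ext => h; apply: functional_extensionality_dep => j.
  exact: (@pcompA S _ _ _ _ (h j) g f).
- move=> X Y f g h; apply: functional_extensionality_dep => j.
  exact: (@pcompDr S _ _ _ (h j) f g).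
Defined.

(** Coordinates [j < i] are zero by the convention of [tr], so these maps form a cocone only modulo
    finitely many coordinates. *)
Definition tr_product i : nattrans (yoneda (E i)) product_module.
Proof.
unshelve refine (@mk_nt S (yoneda (E i)) product_module (fun X => _) _).
- unshelve refine (HB.pack (fun (f : phom X (E i)) =>
    (fun j => @comp S X (E i) (E j) (tr i j) f) : product (fun j => phom X (E j)))
    (GRing.isZmodMorphism.Build _ _ _ _)).
  by move=> g h; apply: functional_extensionality_dep => j; apply: postcomp_is_additive.
- move=> X Y f g; apply: functional_extensionality_dep => j.
  exact: (@pcompA S _ _ _ _ (tr i j) g f).
Defined.

Variables (F : module S) (c : cocone E F).
Hypothesis cF : is_colimit c.

Definition colim_elt i : fval F (E i) := nt_at (c i) (E i) (pid (E i)).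

Lemma colim_eltE i X (f : hom X (E i)) :
  nt_at (c i) X f = act F f (colim_elt i).
Proof. exact: nt_yonedaE. Qed.

Lemma colim_elt_tr i j : (i <= j)%N -> act F (tr i j) (colim_elt j) = colim_elt i.
Proof.
move=> /subnK <-; elim: (j - i)%N => [|m IH]; first by rewrite tr_id act1.
rewrite addSn trS ?leq_addl // actM -[RHS]IH; congr (act _ _ _).
rewrite -[LHS]colim_eltE /colim_elt -[in RHS](cF.1 (m + i)%N).
rewrite -[RHS]/(nt_at (c (m + i).+1) _ (sq_map E (m + i) \c idm _)).
by rewrite compm1.
Qed.

(** The quotient of [F] by all elements coming from the sequence kills every leg of the cocone, so
    by uniqueness its projection is zero. *)
Lemma colim_surj X (x : fval F X) :
  exists i (f : hom X (E i)), x = act F f (colim_elt i).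
Proof.
pose N X (x : fval F X) := exists i (f : hom X (E i)), x = act F f (colim_elt i).
have [|W y z|Y Z f _ [i [g ->]]|Q [p pN]] := @quotient_module S F N.
- by move=> Y; exists 0, (0 : phom _ _); rewrite act_0.
- move=> [i [f ->]] [j [g ->]].
  exists (maxn i j), (tr i (maxn i j) \c f - tr j (maxn i j) \c g).
  by rewrite mod_add act_N !actM !colim_elt_tr ?leq_maxl ?leq_maxr.
- by exists i, (g \c f); rewrite actM.
apply/pN.
have [|a [_ ua]] := cF.2 Q (fun i => nvcomp p (c i)).
  move=> i; rewrite -[in RHS](cF.1 i); symmetry; exact: (@compA (modcat S)).
(* Both sides vanish on every leg, and [p = p + p] forces [p = 0]. *)
have pp : p = nt_add p p.
  transitivity a; [by symmetry; apply: ua | apply: ua => i; apply: nt_ext => Y f].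
  rewrite -[LHS]/(nt_at p Y (nt_at (c i) Y f) + nt_at p Y (nt_at (c i) Y f)).
  rewrite -[RHS]/(nt_at p Y (nt_at (c i) Y f)).
  suff -> : nt_at p Y (nt_at (c i) Y f) = 0 by rewrite addr0.
  by apply/pN; exists i, f; rewrite colim_eltE.
have : nt_at p X x = nt_at p X x + nt_at p X x by rewrite {1}pp.
by move=> /eqP; rewrite -subr_eq0 opprD addNKr oppr_eq0 => /eqP.
Qed.

(** [F] maps to the product of the [Hom(-, E j)] modulo sequences that are eventually zero. There
    [f] becomes the class of the sequence [tr i j \c f]. *)
Lemma colim_inj X i (f : hom X (E i)) :
  act F f (colim_elt i) = 0 -> exists2 j, (i <= j)%N & tr i j \c f = 0.
Proof.
pose N X (x : fval product_module X) := exists k, forall j, (k <= j)%N ->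
  (x : product _) j = 0.
have [|W y z|Y Z g x [k xk]|Q [p pN]] := @quotient_module S product_module N.
- by move=> Y; exists 0.
- move=> [k yk] [l zl]; exists (maxn k l) => j; rewrite geq_max => /andP[kj lj].
  rewrite -[LHS]/((y : product _) j - (z : product _) j).
  by rewrite yk // zl // subr0.
- by exists k => j /xk xj; rewrite -[LHS]/(@comp S _ _ _ ((x : product _) j) g) xj comp0m.
have [|a [ac _]] := cF.2 Q (fun i => nvcomp p (tr_product i)).
  move=> k; apply: nt_ext => Y g.
  rewrite -[LHS]/(nt_at p Y (nt_at (tr_product k.+1) Y (sq_map E k \c (g : hom Y _)))).
  rewrite -[RHS]/(nt_at p Y (nt_at (tr_product k) Y g)).
  apply/eqP; rewrite -subr_eq0 -raddfB; apply/eqP/pN; exists k.+1 => j kj.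
  rewrite -[LHS]/(tr k.+1 j \c (sq_map E k \c (g : hom Y _)) - tr k j \c (g : hom Y _)).
  rewrite compA; have <- : tr k k.+1 = sq_map E k by rewrite trS // tr_id compm1.
  by rewrite tr_comp // subrr.
move=> f0; have : nt_at p X (nt_at (tr_product i) X f) = 0.
  rewrite -[LHS]/(nt_at (nvcomp p (tr_product i)) X f) -ac.
  by rewrite -[LHS]/(nt_at a X (nt_at (c i) X f)) colim_eltE f0 raddf0.
move=> /pN[k kf]; exists (maxn i k); first exact: leq_maxl.
by apply: (kf (maxn i k)); rewrite leq_maxr.
Qed.
End Sequences.

(** * Objects of the completion are representable *)

Section Representability.
Variables (S : tricat) (U : S -> Prop) (G : S).
Hypothesis bU : bounded_aisle U.
Hypothesis gU : generated_by U G.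

Let ax : is_triangulated S := tc_axioms S.
Let aU : aisle U := bounded_is_aisle bU.

Lemma gen_le_aisle : exists b, forall X, gen_le G b X -> U X.
Proof.
have [b Gb] := bounded_above bU G; exists b => X.
elim=> [i bi|A B D u v w d _ IA _ ID|A B D d _ ID].
- rewrite -[shift i G]/(sus_iter i G) -(subnK bi) sus_iterD.
  exact: aisle_sus_iter.
- exact: aisle_ext d IA ID.
- exact: aisle_summand d ID.
Qed.

Lemma gen_le_orth X : exists n, forall A, gen_le G n A -> orth A X.
Proof.
have [b Ub] := gen_le_aisle; have [m mX] := bounded_below bU X.
exists (m + b)%N => A /gen_le_loopD /Ub /mX.
apply: orth_isomorphic (isomorphic_refl _); exact: loop_iterK.
Qed.

Lemma intermediate_aisle n : exists (V : S -> Prop) M,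
  [/\ aisle V, forall X, V X -> gen_le G n X & forall X, gen_le G M X -> V X].
Proof.
have [b Ub] := gen_le_aisle; have [c Uc] := gU.
(* [V] is [U[n + c]]: [c] brings [U] into the class generated by [G], [n] shifts it to level [n],
   and [b] is the level from which that class lies in [U]. *)
exists (fun X => U (loop_iter (n + c) X)), ((n + c) + b)%N.
split=> [|X /Uc|X /gen_le_loopD /Ub //]; first exact: aisle_loop_iter.
move=> /(gen_le_susD n); rewrite addn0 -sus_iterD; apply: gen_le_iso.
exact/isomorphic_sym/loop_iterK.
Qed.

Lemma completion_representable (F : module S) : in_completion G F ->
  exists (B : S) (e : fval F B),
    (forall X (f : hom X B), act F f e = 0 -> f = 0) /\
    (forall X (x : fval F X), exists f : hom X B, x = act F f e).
Proof.
move=> [[E [c [cE cF]]] [n n1 Fn]].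
have [V [M [aV Vn MV]]] := intermediate_aisle n.
have FV X (x : fval F X) : V X -> x = 0 by move=> /Vn /Fn; apply.
(* The extra unit in [M.+1] is spent on the desuspended cone [Z[-1]], which must still lie in
   [V]. *)
have [N EN] := cauchy_tr cE (ltn0Sn M).
have [K [B [k [p [d [VK VB kpd]]]]]] := aisle_trunc aV (E N).
(* Since [F] vanishes on [K], the map [k] dies at a later stage [j], and the transition from [N] to
   [j] factors through [p]. *)
have [|j Nj sk] := colim_inj cF (i := N) (f := k); first exact: FV.
have [s sE] := dist_weak_cokernel kpd sk.
have retract l : (j <= l)%N -> exists r : hom (E l) B,
    r \c tr E N l = p /\ r \c (tr E j l \c s) = idm B.
  move=> jl; have [Z [v [w [dZ ZM]]]] := EN N l (leqnn N) (leq_trans Nj jl).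
  have [u0 [w' dZ']] := dist_rot_inv dZ.
  (* [B] receives no map from the fiber [Z[-1]] of the transition map, so [p] extends to [E l]. *)
  have [|r rE] := dist_weak_cokernel dZ' (f := p).
    by apply: VB; apply/MV/gen_le_loop.
  exists r; split=> //; apply/eqP; rewrite -subr_eq0; apply/eqP.
  have /(dist_rot ax) pd := kpd.
  (* The difference vanishes on [p], hence factors through [K[+1]], which lies in [V] and has no map
     to [B]. *)
  have [|g gE] := dist_weak_cokernel pd (f := r \c (tr E j l \c s) - idm B).
    by rewrite compDl compNl comp1m -!compA -sE tr_comp // -rE subrr.
  by rewrite gE (VB _ _ g) ?comp0m //; apply: aisle_sus.
exists B, (act F s (colim_elt c j)); split=> [X f|X x].
  rewrite -actM => /(colim_inj cF)[l jl sf].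
  have [r [_ rs]] := retract l jl.
  by rewrite -[f]comp1m -rs -!compA sf compm0.
have [i [f ->]] := colim_surj cF x.
have il := leq_maxl i j; have jl := leq_maxr i j; set l := maxn i j in il jl.
have [r [rE _]] := retract l jl.
have Nl := leq_trans Nj jl.
have [Z [v [w [dZ ZM]]]] := EN N l (leqnn N) Nl.
(* This difference vanishes on [E N], so it factors through the cone [Z], where [F] is zero. Thus
   [colim_elt c l] is unchanged by the idempotent through [B]. *)
have [|g gE] := dist_weak_cokernel dZ (f := idm (E l) - tr E j l \c (s \c r)).
  rewrite compDl compNl comp1m -!compA rE -sE.
  by rewrite tr_comp // subrr.
have e0 : act F (g \c v) (colim_elt c l) = 0.
  by rewrite actM (FV Z (act F g _)) ?raddf0 //; apply/MV/(gen_le_leq (leqnSn M)).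
have eE : colim_elt c l = act F (tr E j l \c (s \c r)) (colim_elt c l).
  apply/eqP; rewrite -subr_eq0 -{1}[colim_elt c l](act1 (C := S)) -act_N -mod_add.
  by rewrite -gE in e0; rewrite e0.
exists (r \c (tr E i l \c f)).
rewrite -(colim_elt_tr cF il) -(colim_elt_tr cF jl) -!actM [in LHS]eE -actM.
by rewrite !compA.
Qed.
End Representability.

(** * The Yoneda functor as a triangle equivalence onto the completion *)

Lemma module_iso (C : preadd) (F H : module C) (a : nattrans F H) :
  (forall X (x : fval F X), nt_at a X x = 0 -> x = 0) ->
  (forall X (y : fval H X), exists x, y = nt_at a X x) ->
  @is_iso (modcat C) F H a.
Proof.
move=> inj surj.
pose g X (y : fval H X) : fval F X := sval (cid (surj X y)).
have ag X y : nt_at a X (g X y) = y by exact/esym/(svalP (cid (surj X y))).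
have ainj X (x y : fval F X) : nt_at a X x = nt_at a X y -> x = y.
  move=> xy; apply/eqP; rewrite -subr_eq0; apply/eqP/inj.
  by rewrite raddfB xy subrr.
have gB X : zmod_morphism (g X) by move=> x y; apply: ainj; rewrite raddfB !ag.
pose gA X : {additive fval H X -> fval F X} :=
  HB.pack (g X) (GRing.isZmodMorphism.Build _ _ _ (gB X)).
have gN X Y (f : hom X Y) (y : fval H Y) : gA X (act H f y) = act F f (gA Y y).
  by apply: ainj; rewrite nt_nat -[gA _ _]/(g _ _) -[gA _ _]/(g _ _) !ag.
exists (mk_nt gN); apply: nt_ext => X x.
- by apply: ainj; exact: ag.
- exact: ag.
Qed.

Lemma yoneda_fully_faithful (C : tricat) : fully_faithful (Yo C).
Proof.
move=> X Y; exists (fun a : nattrans (yoneda X) (yoneda Y) => nt_at a X (pid X)).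
- by move=> f; exact: (@pcompm1 C _ _ f).
- move=> a; apply: nt_ext => Z f; exact: esym (@nt_yonedaE C (yoneda Y) X Z a f).
Qed.

Section YonedaShift.
Variable S : tricat.
Implicit Types X E A : S.

Lemma loop_adjunct_inj X E : injective (@loop_adjunct S X E).
Proof.
move=> f g fg; apply/eqP; rewrite -subr_eq0; apply/eqP.
apply: (@loop_reflect_zero S X E[+1] (f - g)).
have [l l1 _] := @loop_sus_counit_iso S E.
have {}fg : adj_counit loop_sus E \c fmap loop (f : hom X _) =
    adj_counit loop_sus E \c fmap loop (g : hom X _) by exact: fg.
by rewrite -[LHS]comp1m -l1 -compA loop_add loopN compDr compNr fg subrr compm0.
Qed.

Lemma loop_adjunct_sus X E (f : hom X[-1] E) :
  loop_adjunct (fmap sus f \c adj_unit loop_sus X) = f.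
Proof.
rewrite /loop_adjunct fmapM compA -loop_sus_counit_nat -compA.
by have -> := adj_triL (@loop_sus S) X; rewrite compm1.
Qed.

Lemma yoneda_shift_iso E :
  @is_iso (modcat S) (yoneda E[+1]) (mod_shift (yoneda E)) (yoneda_shift E).
Proof.
apply: module_iso => [X f|X f].
- by move=> f0; apply: (@loop_adjunct_inj X E); rewrite raddf0; exact: f0.
- by exists (fmap sus (f : hom X[-1] E) \c adj_unit loop_sus X); exact/esym/loop_adjunct_sus.
Qed.

Lemma yoneda_shift_nat X Y (f : hom X Y) :
  @comp (modcat S) _ _ _ (yoneda_shift Y) (fmap (Yo S) (fmap sus f)) =
  @comp (modcat S) _ _ _ (fmap (mod_sus S) (fmap (Yo S) f)) (yoneda_shift X).
Proof.
apply: nt_ext => Z g.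
rewrite -[LHS]/(adj_counit loop_sus Y \c fmap loop (fmap sus f \c (g : hom Z _))).
rewrite -[RHS]/(f \c (adj_counit loop_sus X \c fmap loop (g : hom Z _))).
by rewrite fmapM !compA -loop_sus_counit_nat.
Qed.

Lemma yoneda_add X Y (f g : hom X Y) :
  fmap (Yo S) (f + g : hom X Y) = nt_add (fmap (Yo S) f) (fmap (Yo S) g).
Proof. by apply: nt_ext => Z h; exact: (@pcompDl S _ _ _ f g h). Qed.

Definition const_seq X : seqn S := @Seqn S (fun _ => X) (fun _ => idm X).

Lemma const_seq_trans X i k : sq_trans (const_seq X) i k = idm X.
Proof. by elim: k => //= k ->; exact: (@comp1m S X X). Qed.

Lemma const_seq_cauchy G X : is_cauchy G (const_seq X).
Proof.
move=> n _; exists 0 => i k _; have [O O0] := has_zero_ob (tc_axioms S).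
exists O, 0, 0; rewrite const_seq_trans; split; last exact: gen_le_zero.
exact: (dist_id (tc_axioms S)).
Qed.

Definition const_cocone X : cocone (const_seq X) (Yo S X) :=
  fun _ => idm (Yo S X).

Lemma const_colimit X : is_colimit (@const_cocone X).
Proof.
split=> [i|H d dc].
  by rewrite -[LHS]/(idm (Yo S X) \c fmap (Yo S) (idm X)) fmap1 comp1m.
exists (d 0); split=> [i|a ad]; last by rewrite -(ad 0) compm1.
by rewrite compm1; elim: i => // i ->; rewrite -[LHS]dc [fmap _ _](fmap1 (Yo S) X) compm1.
Qed.
End YonedaShift.

Section Comparison.
Variables (S : tricat) (U : S -> Prop) (G : S).
Hypothesis bU : bounded_aisle U.
Hypothesis gU : generated_by U G.

Lemma yoneda_in_completion X : in_completion G (Yo S X).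
Proof.
split; first by exists (const_seq X), (@const_cocone S X); split;
  [apply: const_seq_cauchy | apply: const_colimit].
(* The successor only secures the positive index required by [in_C]. *)
have [n nX] := gen_le_orth G bU X; exists n.+1 => // A /(gen_le_leq (leqnSn n)).
exact: nX.
Qed.

Definition yoneda_functor : functor S (compl_cat G) :=
  @Functor S (compl_cat G) (fun X => exist _ (Yo S X) (yoneda_in_completion X))
    (fun X Y f => fmap (Yo S) f) (fun X => fmap1 (Yo S) X)
    (fun X Y Z g f => fmapM (Yo S) g f).

Lemma yoneda_functor_equivalence : is_equivalence yoneda_functor.
Proof.
apply: fully_faithful_equivalence => [X Y|[F FG]].
  exact: (@yoneda_fully_faithful S X Y).
have [B [e [inj surj]]] := completion_representable bU gU FG.
exists B; exists (yo_elt e).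
have [g ge eg] : @is_iso (modcat S) (yoneda B) F (yo_elt e).
  by apply: module_iso => X x; [apply: inj | apply: surj].
by exists g.
Qed.

Definition yoneda_shift_trans :
  nattrans (fcomp yoneda_functor (sc_sus (sh_of S)))
           (fcomp (sc_sus (completion G)) yoneda_functor) :=
  @NatTrans (sh_of S) (completion G)
    (fcomp yoneda_functor (sc_sus (sh_of S)))
    (fcomp (sc_sus (completion G)) yoneda_functor)
    (fun X => yoneda_shift X) (fun X Y f => @yoneda_shift_nat S X Y f).

(** A triangle is the colimit of the constant sequence on itself. *)
Lemma yoneda_dist (X Y Z : S) (u : hom X Y) (v : hom Y Z) (w : hom Z X[+1]) :
  dist u v w ->
  @sc_dist (completion G) (yoneda_functor X) (yoneda_functor Y)
    (yoneda_functor Z) (fmap yoneda_functor u) (fmap yoneda_functor v)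
    (yoneda_shift_trans X \c fmap yoneda_functor w).
Proof.
move=> d; exists (const_seq X), (const_seq Y), (const_seq Z).
exists (fun _ => u), (fun _ => v), (fun _ => w).
exists (@const_cocone S X), (@const_cocone S Y), (@const_cocone S Z).
split=> //.
- move=> i; split.
  + exact: etrans (comp1m u) (esym (compm1 u)).
  + exact: etrans (comp1m v) (esym (compm1 v)).
  + by rewrite -[LHS]/(fmap sus (idm X) \c w) fmap1 comp1m; exact: esym (compm1 w).
- by split; apply: const_seq_cauchy.
- by split; apply: const_colimit.
- move=> i; split.
  + exact: etrans (compm1 _) (esym (comp1m _)).
  + exact: etrans (compm1 _) (esym (comp1m _)).
  + apply: (etrans (compm1 _)); congr (_ \c _).
    rewrite -[RHS]/(fmap (mod_sus S) (idm (Yo S X)) \c yoneda_shift X).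
    by rewrite fmap1; exact: esym (comp1m _).
Qed.

Definition yoneda_trifunctor : trifunctor (sh_of S) (completion G).
Proof.
apply: (@TriFunctor (sh_of S) (completion G) yoneda_functor _ yoneda_shift_trans).
- exact: yoneda_add.
- move=> X; have [g ge eg] := yoneda_shift_iso X.
  by exists g.
- exact: yoneda_dist.
Defined.
End Comparison.

(** * The Yoneda functor reflects triangles *)

Section RepresentableColimit.
Variables (S : tricat) (a : seqn S) (A : S) (p : cocone a (Yo S A)).
Hypothesis pA : is_colimit p.

Definition colim_proj i : hom (a i) A := @colim_elt S a (yoneda A) p i.

Lemma colim_proj_tr i j : (i <= j)%N -> colim_proj j \c tr a i j = colim_proj i.
Proof. exact: (@colim_elt_tr S a (yoneda A) p pA). Qed.

(** The identity of [A], as an element of the colimit, comes from some stage, and may be pushed to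
    any later one. *)
Lemma colim_proj_section K : exists i (s : hom A (a i)),
  (K <= i)%N /\ colim_proj i \c s = idm A.
Proof.
have [i [s sE]] := @colim_surj S a (yoneda A) p pA A (idm A).
exists (maxn K i), (tr a i (maxn K i) \c s); split; first exact: leq_maxl.
by rewrite compA colim_proj_tr ?leq_maxr //; exact: esym sE.
Qed.

Lemma colim_proj_inj X i (f : hom X (a i)) : colim_proj i \c f = 0 ->
  exists2 j, (i <= j)%N & tr a i j \c f = 0.
Proof. exact: (@colim_inj S a (yoneda A) p pA). Qed.

(** For a section [s] at stage [k], the maps [tr a i k] and [s \c colim_proj i] agree after
    projection to [A], hence already at some later stage. *)
Lemma colim_proj_factor i : exists j (s : hom A (a j)),
  (i <= j)%N /\ tr a i j = s \c colim_proj i.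
Proof.
have [k [s [ik sE]]] := colim_proj_section i.
have [|j kj] := @colim_proj_inj _ k (tr a i k - s \c colim_proj i).
  by rewrite compDr compNr compA sE comp1m colim_proj_tr // subrr.
rewrite compDr compNr tr_comp // compA => /eqP; rewrite subr_eq0 => /eqP E.
by exists j, (tr a k j \c s); split=> //; exact: leq_trans kj.
Qed.
End RepresentableColimit.

Section SequenceMorphisms.
Variable S : tricat.

Lemma tr_nat (a b : seqn S) (u : forall i, hom (a i) (b i)) :
  (forall i, sq_map b i \c u i = u i.+1 \c sq_map a i) ->
  forall i j, (i <= j)%N -> tr b i j \c u i = u j \c tr a i j.
Proof.
move=> uN i j /subnK <-; elim: (j - i)%N => [|m IH].
  by rewrite !tr_id comp1m compm1.
by rewrite addSn !trS ?leq_addl // -compA IH compA uN compA.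
Qed.

Lemma tr_sus (a : seqn S) i j : (i <= j)%N ->
  tr (seq_sus a) i j = fmap sus (tr a i j).
Proof.
move=> /subnK <-; elim: (j - i)%N => [|m IH]; first by rewrite !tr_id fmap1.
by rewrite addSn !trS ?leq_addl // fmapM IH.
Qed.
End SequenceMorphisms.

Section TriangleReflection.
Variables (S : tricat) (G : S).
Variables (A B C : S) (u : hom A B) (v : hom B C) (w : hom C A[+1]).

Let ax : is_triangulated S := tc_axioms S.

Lemma colim_triangle_reflect :
  colim_triangle G (fmap (Yo S) u) (fmap (Yo S) v)
    (@comp (modcat S) (Yo S C) (Yo S A[+1]) (mod_sus S (Yo S A))
       (yoneda_shift A) (fmap (Yo S) w)) ->
  dist u v w.
Proof.
move=> [a [b [c [ui [vi [wi [p [q [r [duvw nuvw _ [pA qB rC] fgh]]]]]]]]]].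
pose pr := colim_proj p; pose qr := colim_proj q; pose rr := colim_proj r.
(* The equations between natural transformations become equations in [S] by evaluation at
   identities. *)
have upE i : u \c pr i = qr i \c ui i.
  have [E _ _] := fgh i.
  have := congr1 (fun h : nattrans (yoneda (a i)) (yoneda B) => nt_at h (a i) (pid (a i))) E.
  rewrite -[LHS]/(u \c pr i) => ->.
  rewrite -[LHS]/(nt_at (q i) (a i) (ui i \c idm (a i))) compm1.
  exact: (@colim_eltE S b (yoneda B) q).
have vqE i : v \c qr i = rr i \c vi i.
  have [_ E _] := fgh i.
  have := congr1 (fun h : nattrans (yoneda (b i)) (yoneda C) => nt_at h (b i) (pid (b i))) E.
  rewrite -[LHS]/(v \c qr i) => ->.
  rewrite -[LHS]/(nt_at (r i) (b i) (vi i \c idm (b i))) compm1.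
  exact: (@colim_eltE S c (yoneda C) r).
have wrE i : w \c rr i = fmap sus (pr i) \c wi i.
  have [_ _ E] := fgh i.
  have := congr1 (fun h : nattrans (yoneda (c i)) (mod_shift (yoneda A)) =>
    nt_at h (c i) (pid (c i))) E.
  rewrite -[LHS]/(loop_adjunct (w \c rr i)).
  rewrite -[RHS]/(nt_at (cocone_shift p i) (c i) (wi i \c idm (c i))) compm1.
  rewrite cocone_shiftE [nt_at (p i) _ _](@colim_eltE S a (yoneda A) p).
  rewrite -[RHS]/(pr i \c (adj_counit loop_sus (a i) \c fmap loop (wi i))).
  rewrite compA loop_sus_counit_nat -compA -fmapM => E'.
  exact: loop_adjunct_inj E'.
have nu i j (ij : (i <= j)%N) := tr_nat (fun k => let: And3 h _ _ := nuvw k in h) ij.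
have nv i j (ij : (i <= j)%N) := tr_nat (fun k => let: And3 _ h _ := nuvw k in h) ij.
have nw i j (ij : (i <= j)%N) : fmap sus (tr a i j) \c wi i = wi j \c tr c i j.
  rewrite -tr_sus //; apply: (@tr_nat S c (seq_sus a)) => // k.
  by have [] := nuvw k.
have [i0 [al0 [_ al0E]]] := colim_proj_section pA 0.
have [i [be [i0i beE]]] := colim_proj_section qB i0.
have prE : pr i \c (tr a i0 i \c al0) = idm A by rewrite compA colim_proj_tr.
(* The sections of [pr] and [qr] commute with [u] only in the colimit, hence from some stage [j]
   on. *)
have [|j ij] := @colim_proj_inj S b B q qB A i (ui i \c (tr a i0 i \c al0) - be \c u).
  rewrite compDr compNr compA -[colim_proj q i]/(qr i) -upE -compA prE compm1.
  by rewrite compA beE comp1m subrr.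
rewrite compDr compNr => /eqP; rewrite subr_eq0 !compA nu // -!compA => /eqP E.
pose al := tr a i j \c (tr a i0 i \c al0); pose be' := tr b i j \c be.
have alE : pr j \c al = idm A by rewrite /al compA colim_proj_tr.
have be'E : qr j \c be' = idm B by rewrite /be' compA colim_proj_tr.
have {}E : be' \c u = ui j \c al by rewrite /be' -compA -E.
have [C' [v' [w' d']]] := dist_cone ax u.
(* [ga] maps the cone [C'] of [u] to the triangle at stage [j]; composed with [rr j] it compares
   [C'] with [C]. *)
have [ga [gav gaw]] := dist_mor ax d' (duvw j) E.
have psv : rr j \c ga \c v' = v by rewrite -compA gav compA -vqE -compA be'E compm1.
have psw : w \c (rr j \c ga) = w'.
  by rewrite compA wrE -compA -gaw compA -fmapM alE fmap1 comp1m.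
have uw : fmap sus u \c w = 0.
  have [k [s [_ sE]]] := colim_proj_section rC 0.
  have /(dist_rot ax) /(dist_rot ax) /dist_comp0 := duvw k.
  rewrite compNl => /eqP; rewrite oppr_eq0 => /eqP uw0.
  have wE : w = fmap sus (pr k) \c (wi k \c s).
    by rewrite compA -wrE -compA [_ \c s]sE compm1.
  by rewrite wE compA -fmapM upE fmapM -compA (compA _ (wi k)) uw0 comp0m compm0.
have psi : is_iso (rr j \c ga).
  (* Exactness is checked by lifting [f] to a stage [k], moving to a stage [l] whose transition map
     factors through the colimit, using the triangle there, and projecting back. *)
  apply: (five_lemma d' psv psw uw) => W f f0.
  - have [k [s [_ sE]]] := colim_proj_section rC 0.
    have [l [t [kl tE]]] := colim_proj_factor pA k.
    have [|g gE] := dist_weak_kernel (iffLR (dist_rot ax _ _ _) (duvw l))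
        (f := tr c k l \c (s \c f)).
      rewrite compA -nw // tE fmapM -[colim_proj p k]/(pr k) -!compA (compA _ (wi k)).
      by rewrite -wrE -compA (compA _ s) [_ \c s]sE comp1m f0 compm0.
    exists (qr l \c g); rewrite compA vqE -compA -gE compA colim_proj_tr //.
    by rewrite compA sE comp1m.
  - have [k [s [_ sE]]] := colim_proj_section qB 0.
    have [l [t [kl tE]]] := colim_proj_factor rC k.
    have [|g gE] := dist_weak_kernel (duvw l) (f := tr b k l \c (s \c f)).
      rewrite compA -nv // tE -[colim_proj r k]/(rr k) -!compA (compA _ (vi k)).
      by rewrite -vqE -compA (compA _ s) [_ \c s]sE comp1m f0 compm0.
    exists (pr l \c g); rewrite compA upE -compA -gE compA colim_proj_tr //.
    by rewrite compA sE comp1m.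
apply: (dist_iso ax (iso_id A) (iso_id B) psi) d'.
- by rewrite comp1m compm1.
- by rewrite psv compm1.
- by rewrite fmap1 comp1m psw.
Qed.
End TriangleReflection.

Theorem corollary1p3 (R S T : tricat)
  (R_small : essentially_small R)
  (S_small : essentially_small S)
  (T_small : essentially_small T)
  (R_findim : findim_finite (op_tri R))
  (T_findim : findim_finite (op_tri T))
  (R_bounded : exists t : tstructure R, t_bounded t)
  (T_bounded : exists t : tstructure T, t_bounded t)
  (rec : recollement R S T) :
  regular S.
Proof.
have [tR /taisle_bounded bR] := R_bounded.
have [tT /taisle_bounded bT] := T_bounded.
have [GR gR] := findim_generated R_findim bR.
have [GT gT] := findim_generated T_findim bT.
have bS := glued_bounded rec bR bT.
have [G gS] := glued_generated rec gR gT.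
exists G, (yoneda_trifunctor G bS); split.
  exact: yoneda_functor_equivalence gS.
by move=> X Y Z u v w; exact: colim_triangle_reflect.
Qed.
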